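(* Let $\mathcal{F}=\{K_4^-,F_6\}$. If $n\geq 3$ and $n\neq 5$, then, up to isomorphism, $S_3(n)$ is the unique $\mathcal{F}$-free $3$-graph with $n$ vertices and $\mathrm{ex}(n,\mathcal{F})$ edges. If $n=5$, then, up to isomorphism, $C_5^{(3)}$ is the unique $\mathcal{F}$-free $3$-graph with $5$ vertices and $\mathrm{ex}(5,\mathcal{F})$ edges.
   Context: A $3$-graph $G=(V(G),E(G))$ consists of a finite vertex set $V(G)$ and a set $E(G)$ of $3$-element subsets of $V(G)$ (edges); $xyz$ abbreviates $\{x,y,z\}$. The number of vertices is the order of $G$ and $e(G)=|E(G)|$ is its size. For a family $\mathcal{F}$ of $3$-graphs, $G$ is $\mathcal{F}$-free if it contains no (not necessarily induced) subgraph isomorphic to a member of $\mathcal{F}$, and for $n\ge 3$, $\mathrm{ex}(n,\mathcal{F})=\max\{e(G): G \text{ an } \mathcal{F}\text{-free } 3\text{-graph of order } n\}$. The following $3$-graphs are given by their edge sets: $K_4^-=\{123,124,134\}$ (vertex set $\{1,2,3,4\}$), $F_6=\{123,124,345,156\}$ (vertex set $\{1,\dots,6\}$), $C_5^{(3)}=\{123,234,345,145,125\}$ (vertex set $\{1,\dots,5\}$). $S_3(n)$ is the complete balanced tripartite $3$-graph of order $n$: its vertex set of size $n$ is partitioned into three classes with sizes as equal as possible, and its edges are exactly the triples with one vertex in each class. *)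

(* Defs.v *)
From HB Require Import structures.
From mathcomp Require Import all_boot zify.

Set Implicit Arguments.
Unset Strict Implicit.
Unset Printing Implicit Defensive.

Record graph3 (V : finType) := Graph3 {
  edges : {set {set V}};
  edgesP : [forall e in edges, #|e| == 3]
}.

HB.instance Definition _ (V : finType) := [isSub for @edges V].
HB.instance Definition _ (V : finType) := [Finite of graph3 V by <:].

Record packed_graph3 := Pack { vertices : finType; graph : graph3 vertices }.

Definition contains (V W : finType) (G : graph3 V) (H : graph3 W) : bool :=
  [exists f : {ffun W -> V},
     injectiveb f && [forall e in edges H, f @: e \in edges G]].

Definition free (F : seq packed_graph3) (V : finType) (G : graph3 V) : bool :=
  all (fun H => ~~ contains G (graph H)) F.

(* Every 3-graph of order n is isomorphic to one with vertex set 'I_n, so the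
   maximum is taken over the latter. *)
Definition exn (n : nat) (F : seq packed_graph3) : nat :=
  \max_(G : graph3 'I_n | free F G) #|edges G|.

Definition isomorphic (V W : finType) (G : graph3 V) (H : graph3 W) : Prop :=
  exists2 f : V -> W, bijective f &
    forall e : {set V}, (e \in edges G) = (f @: e \in edges H).

Definition extremal (n : nat) (F : seq packed_graph3)
    (V : finType) (G : graph3 V) : Prop :=
  [/\ #|V| = n, free F G & #|edges G| = exn n F].

Definition unique_extremal (n : nat) (F : seq packed_graph3)
    (W : finType) (H : graph3 W) : Prop :=
  extremal n F H /\
  forall (V : finType) (G : graph3 V), extremal n F G -> isomorphic G H.

(* Vertices are labelled 1, ..., n: the element i of 'I_n carries the label
   i.+1. *)
Definition triple (n a b c : nat) : {set 'I_n} :=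
  [set i : 'I_n | i.+1 \in [:: a; b; c]].

Definition K4m_edges : {set {set 'I_4}} :=
  [set triple 4 1 2 3; triple 4 1 2 4; triple 4 1 3 4].

Definition F6_edges : {set {set 'I_6}} :=
  [set triple 6 1 2 3; triple 6 1 2 4; triple 6 3 4 5; triple 6 1 5 6].

Definition C5_edges : {set {set 'I_5}} :=
  [set triple 5 1 2 3; triple 5 2 3 4; triple 5 3 4 5;
       triple 5 1 4 5; triple 5 1 2 5].

Lemma card_triple (n a b c : nat) :
  #|triple n a b c| = \sum_(i < n) (i.+1 \in [:: a; b; c]).
Proof. by rewrite -sum1_card big_mkcond; apply: eq_bigr => i _; rewrite inE; case: ifP. Qed.

Lemma K4m_edgesP : [forall e in K4m_edges, #|e| == 3].
Proof.
apply/forall_inP => e; rewrite !inE -!orbA.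
by do ?[case/orP]; move/eqP->; rewrite card_triple !big_ord_recl big_ord0.
Qed.

Lemma F6_edgesP : [forall e in F6_edges, #|e| == 3].
Proof.
apply/forall_inP => e; rewrite !inE -!orbA.
by do ?[case/orP]; move/eqP->; rewrite card_triple !big_ord_recl big_ord0.
Qed.

Lemma C5_edgesP : [forall e in C5_edges, #|e| == 3].
Proof.
apply/forall_inP => e; rewrite !inE -!orbA.
by do ?[case/orP]; move/eqP->; rewrite card_triple !big_ord_recl big_ord0.
Qed.

Definition K4m : graph3 'I_4 := Graph3 K4m_edgesP.
Definition F6 : graph3 'I_6 := Graph3 F6_edgesP.
Definition C5 : graph3 'I_5 := Graph3 C5_edgesP.

Definition K4m_F6 : seq packed_graph3 := [:: Pack K4m; Pack F6].

(* The three classes of S_3(n) are the residue classes modulo 3; their sizes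
   differ by at most one (S3_balanced). *)
Definition S3_class (n : nat) (c : 'I_3) : {set 'I_n} :=
  [set i : 'I_n | i %% 3 == c].

Definition S3_edges (n : nat) : {set {set 'I_n}} :=
  [set e : {set 'I_n} | [forall c : 'I_3, #|e :&: S3_class n c| == 1]].

Lemma S3_edgesP (n : nat) : [forall e in S3_edges n, #|e| == 3].
Proof.
apply/forall_inP => e; rewrite inE => /forallP eP.
pose r (i : 'I_n) : 'I_3 := Ordinal (ltn_pmod i (isT : 0 < 3)).
rewrite -sum1_card (partition_big r xpredT) //=.
under eq_bigr => c _.
  rewrite sum1_card.
  have -> : #|[pred i | (i \in e) && (r i == c)]| = 1.
    by apply: etrans (eqP (eP c)); apply: eq_card => i; rewrite !inE.
  over.
by rewrite sum1_card card_ord.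
Qed.

Lemma card_S3_class (n : nat) (c : 'I_3) : #|S3_class n c| = (n + 2 - c) %/ 3.
Proof.
have cardE m : #|S3_class m c| = \sum_(i < m) (i %% 3 == c).
  by rewrite -sum1_card big_mkcond; apply: eq_bigr => i _; rewrite inE; case: ifP.
have c3 := ltn_ord c.
rewrite cardE; elim: n => [|n IHn]; first by rewrite big_ord0; lia.
by rewrite big_ord_recr /= {}IHn; lia.
Qed.

Lemma S3_balanced (n : nat) (c d : 'I_3) :
  #|S3_class n c| <= #|S3_class n d|.+1.
Proof. by rewrite !card_S3_class; have := ltn_ord d; lia. Qed.

Definition S3 (n : nat) : graph3 'I_n := Graph3 (S3_edgesP n).

(* Main.v *)
Require Import Defs.
From mathcomp Require Import all_boot zify.

Set Implicit Arguments.
Unset Strict Implicit.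
Unset Printing Implicit Defensive.

(** S_3(n) and C_5 are free of the two 3-graphs and have s3 n and 5 edges, so everything rests
    on the bound e(G) <= s3 n + [n = 5] for a free 3-graph G of order n and on the shape of G in
    the case of equality. Both come from the removal of an edge, by induction on n.

    Let xyz be an edge and m = n - 3. Since s3 n = s3 m + 1 + m + floor(m^2 / 3), and since by
    K_4^- each of the m other vertices forms an edge with at most one of the pairs of xyz
    (joins_le1), it is enough that the sum T, over the pairs uv of other vertices, of the number
    wt u v of ends of xyz that form an edge with uv is at most m^2 / 3. Call these ends the
    colours of uv. The two forbidden 3-graphs together say that the sides of a triangle of
    coloured pairs have disjoint sets of colours (colour_disjoint). This leaves four cases.

    If four vertices are pairwise joined by coloured pairs, their three colours are those of the
    proper colouring of K_4, and the seven vertices form a Fano plane (K4_fano). The same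
    argument with seven colours in place of three bounds the degrees of the points of the plane,
    and one of them is smaller than s3 n - s3 (n - 1), so that this point can be removed
    (fano_lt).

    If there is no such K_4 and each pair has at most one colour, then T <= m^2 / 3 is Turan's
    theorem.

    Pairs with several colours are in no triangle of coloured pairs (multi_no_triangle), and they
    are removed one by one before Turan's theorem is applied (multi_del, peel). A pair with
    exactly two colours is costly when many pairs at its ends also have two colours. But then an
    end of the pair is in no edge with the third vertex of xyz (dbl2_unmet). Such idle vertices
    form no edge with two vertices of xyz, and their number compensates for the cost. If a
    third of all vertices are idle at the same vertex of xyz, then Mantel's theorem in the link
    of that vertex gives it a degree below s3 n - s3 (n - 1) (low_unmet).

    The compensation fails only for a pair with two colours that spans a copy of C_5 with xyz. A
    vertex outside this copy forms an edge with at most one of its pairs (cyc5_meet), and the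
    removal of xyz and then of the pair gives a strict inequality unless n = 5 (step_C5). For
    n = 5 a value of 5 can only come from this case, and G contains C_5 (N3_bound5).

    In the case of equality and n <> 5, a pair with two colours always leads to a strict
    inequality. So for each edge xyz every vertex forms an edge with exactly one pair of xyz, or
    is one of its vertices; this splits the vertices into three classes, and an edge with two
    vertices in one class would give a pair with two colours (N3_equality). Hence G is
    tripartite, and the sizes of the classes are those of S_3(n) because a product of three
    numbers with a given sum attains s3 only when they are balanced (prod_s3_balanced). *)

(** * Arithmetic of the size of the balanced complete tripartite 3-graph *)

Definition s3 (n : nat) : nat := (n %/ 3) * ((n + 1) %/ 3) * ((n + 2) %/ 3).

Lemma mod3_cases n :
  exists k, [\/ n = 3 * k, n = 3 * k + 1 | n = 3 * k + 2].
Proof.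
exists (n %/ 3).
have [||] : [\/ n %% 3 = 0, n %% 3 = 1 | n %% 3 = 2].
- by have := ltn_pmod n (isT : 0 < 3); case: (n %% 3) => [|[|[|]]] //;
    [constructor 1|constructor 2|constructor 3].
- by move=> h; constructor 1; lia.
- by move=> h; constructor 2; lia.
- by move=> h; constructor 3; lia.
Qed.

Lemma s3_0 k : s3 (3 * k) = k * k * k.
Proof. by rewrite /s3; congr (_ * _ * _); lia. Qed.

Lemma s3_1 k : s3 (3 * k + 1) = k * k * k.+1.
Proof. by rewrite /s3; congr (_ * _ * _); lia. Qed.

Lemma s3_2 k : s3 (3 * k + 2) = k * k.+1 * k.+1.
Proof. by rewrite /s3; congr (_ * _ * _); lia. Qed.

(** The increment counts the edges of S_3(m + 3) that meet a fixed edge: that edge, one edge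
    with two of its vertices for each of the other m, and one edge for each pair of these in
    different classes. *)
Lemma s3_add3 m : s3 (m + 3) = s3 m + 1 + m + (m * m) %/ 3.
Proof.
have [k [||] ->] := mod3_cases m.
- have -> : 3 * k + 3 = 3 * k.+1 by lia.
  have -> : 3 * k * (3 * k) %/ 3 = 3 * k * k by nia.
  by rewrite !s3_0; nia.
- have -> : 3 * k + 1 + 3 = 3 * k.+1 + 1 by lia.
  have -> : (3 * k + 1) * (3 * k + 1) %/ 3 = 3 * k * k + 2 * k by nia.
  by rewrite !s3_1; nia.
- have -> : 3 * k + 2 + 3 = 3 * k.+1 + 2 by lia.
  have -> : (3 * k + 2) * (3 * k + 2) %/ 3 = 3 * k * k + 4 * k + 1 by nia.
  by rewrite !s3_2; nia.
Qed.

(** In an induction on the order, a vertex of degree below n^2 / 9 can thus be removed, n being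
    the number of the other vertices. *)
Lemma s3_succ n : 1 < n -> n * n + 9 * s3 n <= 9 * s3 n.+1.
Proof.
have [k [||] ->] := mod3_cases n => n_gt1.
- have -> : (3 * k).+1 = 3 * k + 1 by lia.
  by rewrite s3_0 s3_1; nia.
- have -> : (3 * k + 1).+1 = 3 * k + 2 by lia.
  by rewrite s3_1 s3_2; nia.
- have -> : (3 * k + 2).+1 = 3 * k.+1 by lia.
  by rewrite s3_2 s3_0; nia.
Qed.

(** A vertex whose link has no triangle and lives on q of the n other vertices can be removed as
    well: 2 * l <= q * q is Mantel's theorem for the l ordered pairs of the link. The term
    (n == 5) is the place of C_5 in the induction hypothesis. *)
Lemma s3_low n l q : 4 <= n -> 2 * l <= q * q -> 3 * q + 1 <= 2 * n ->
  6 * (s3 n + (n == 5)) + 3 * l < 6 * s3 n.+1.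
Proof.
have [-> _ h1 h2|n5 n_ge h1 h2] := eqVneq n 5.
  have : q <= 3 by lia.
  by rewrite /s3 /=; nia.
rewrite addn0.
have [k [||] e] := mod3_cases n; subst n.
- have -> : (3 * k).+1 = 3 * k + 1 by lia.
  have : q < 2 * k by lia.
  by rewrite s3_0 s3_1; nia.
- have -> : (3 * k + 1).+1 = 3 * k + 2 by lia.
  have : q <= 2 * k by lia.
  by rewrite s3_1 s3_2; nia.
- have -> : (3 * k + 2).+1 = 3 * k.+1 by lia.
  have : q <= 2 * k + 1 by lia.
  by rewrite s3_2 s3_0; nia.
Qed.

Lemma square_div3 m : 2 * (m * m) <= 6 * (m * m %/ 3) + 2.
Proof.
have [k [||] ->] := mod3_cases m.
- have -> : 3 * k * (3 * k) %/ 3 = 3 * k * k by nia.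
  lia.
- have -> : (3 * k + 1) * (3 * k + 1) %/ 3 = 3 * k * k + 2 * k by nia.
  lia.
- have -> : (3 * k + 2) * (3 * k + 2) %/ 3 = 3 * k * k + 4 * k + 1 by nia.
  lia.
Qed.

(** The estimate that ends the recursion of peel below. The total weight is p; x0, x1, x2 and y
    count the removed pairs of each kind, e0, e1 and e2 the vertices idle at each end of the
    fixed edge, and i all idle vertices. As e_k is at most about m / 3, the products x_k * e_k
    are absorbed by the term k * m, and k * k by the squares of the x_k, through the Cauchy
    inequality, and by k * m. *)
Section PeelArith.
Variables m x0 x1 x2 y e0 e1 e2 p i : nat.
Let k := x0 + x1 + x2 + y.
Hypothesis km : 2 * k <= m.

Let cauchy : (x0 + x1 + x2) * (x0 + x1 + x2) <= 3 * (x0 * x0 + x1 * x1 + x2 * x2).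
Proof.
have := (nat_Cauchy x0 x1).1; have := (nat_Cauchy x1 x2).1; have := (nat_Cauchy x0 x2).1.
by rewrite -!mulnn; clear; lia.
Qed.

Let cross : 4 * ((x0 + x1 + x2) * y) + 4 * (y * y) <= 2 * (y * m).
Proof.
have : y * (2 * (2 * k)) <= y * (2 * m) by rewrite leq_mul2l leq_mul2l km !orbT.
by rewrite /k; clear; lia.
Qed.

Lemma peel_bound0 : 3 * e0 <= m + 2 -> 3 * e1 <= m + 2 -> 3 * e2 <= m + 2 ->
  3 * p + 2 * (k * m) + 6 * (x0 * x0 + x1 * x1 + x2 * x2) + 18 * (x0 + x1 + x2) + 6 * y
    <= 2 * (m * m) + 2 * (k * k) + 6 * k + 6 * (x0 * e0 + x1 * e1 + x2 * e2) + 6 * i ->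
  3 * p <= 2 * (m * m) + 6 * i /\ (0 < k -> 2 < m -> 3 * p + 4 <= 2 * (m * m) + 6 * i).
Proof.
move=> h0 h1 h2.
have {}h0 : x0 * (3 * e0) <= x0 * (m + 2) by rewrite leq_mul2l h0 orbT.
have {}h1 : x1 * (3 * e1) <= x1 * (m + 2) by rewrite leq_mul2l h1 orbT.
have {}h2 : x2 * (3 * e2) <= x2 * (m + 2) by rewrite leq_mul2l h2 orbT.
move=> ineq.
have main : 3 * p + 2 * (y * y) + 8 * (x0 + x1 + x2) <= 2 * (m * m) + 6 * i.
  by move: ineq h0 h1 h2 cauchy cross; rewrite /k; clear; lia.
split=> [|k_gt0 m_gt2]; first by move: main; clear; lia.
have [X0|] := posnP (x0 + x1 + x2); last by move: main; clear; nia.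
have [y2|y1] := leqP 2 y; first by move: main X0 y2; clear; nia.
have [e_x0 [e_x1 [e_x2 e_y]]] : x0 = 0 /\ x1 = 0 /\ x2 = 0 /\ y = 1.
  by move: X0 y1 k_gt0; rewrite /k; clear; lia.
by move: ineq m_gt2; rewrite /k e_x0 e_x1 e_x2 e_y; clear; lia.
Qed.

(** Here each of the y removals may cost 6 more; 6 * y - 2 * y * y is at most 4. *)
Lemma peel_bound1 : 3 * e0 <= m + 4 -> 3 * e1 <= m + 4 -> 3 * e2 <= m + 4 ->
  3 * p + 2 * (k * m) + 6 * (x0 * x0 + x1 * x1 + x2 * x2) + 18 * (x0 + x1 + x2) + 6 * y
    <= 2 * (m * m) + 2 * (k * k) + 6 * k + 6 * (x0 * e0 + x1 * e1 + x2 * e2) + 6 * i + 6 * y ->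
  3 * p <= 2 * (m * m) + 6 * i + 4.
Proof.
move=> h0 h1 h2.
have {}h0 : x0 * (3 * e0) <= x0 * (m + 4) by rewrite leq_mul2l h0 orbT.
have {}h1 : x1 * (3 * e1) <= x1 * (m + 4) by rewrite leq_mul2l h1 orbT.
have {}h2 : x2 * (3 * e2) <= x2 * (m + 4) by rewrite leq_mul2l h2 orbT.
have y2 : 6 * y <= 2 * (y * y) + 4 by clear; case: y => [|[|z]]; nia.
move=> ineq; have main : 3 * p + 2 * (y * y) <= 2 * (m * m) + 6 * i + 6 * y.
  by move: ineq h0 h1 h2 cauchy cross; rewrite /k; clear; lia.
by move: main y2; clear; lia.
Qed.

End PeelArith.

(** * Weights on pairs and Turan's theorem *)

Section PairSums.
Variable V : finType.
Implicit Types (f : V -> V -> nat) (h : rel V) (K W : {set V}).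

(** Sums run over ordered pairs, and below over ordered triples. Hence a pair counts twice and an
    edge six times, hence the coefficients 2, 3 and 6 in the bounds below. *)
Definition psum f W := \sum_(u in W) \sum_(v in W) f u v.

Lemma psum_split f K W : (forall u v, f u v = f v u) -> K \subset W ->
  psum f W = psum f K + 2 * (\sum_(u in W :\: K) \sum_(v in K) f u v)
             + psum f (W :\: K).
Proof.
move=> fC sKW; have WK : W :&: K = K by apply/setIidPr.
have splitW (F : V -> nat) :
    \sum_(v in W) F v = \sum_(v in K) F v + \sum_(v in W :\: K) F v.
  by rewrite (big_setID K) WK.
rewrite /psum splitW.
under eq_bigr do rewrite splitW.
under [X in _ + X]eq_bigr do rewrite splitW.
rewrite !big_split /= [X in _ + X + _]exchange_big /=.
under [X in _ + X + _]eq_bigr => u _ do under eq_bigr do rewrite fC.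
by lia.
Qed.

Lemma leq_psum f g W : {in W &, forall u v, f u v <= g u v} ->
  psum f W <= psum g W.
Proof. by move=> fg; do 2![apply: leq_sum => ? ?]; apply: fg. Qed.

Lemma psumD f g W : psum (fun u v => f u v + g u v) W = psum f W + psum g W.
Proof. by rewrite -big_split; apply: eq_bigr => u _; rewrite big_split. Qed.

Lemma sum_set2 (F : V -> nat) a b : a != b ->
  \sum_(v in [set a; b]) F v = F a + F b.
Proof. by move=> ab; rewrite big_setU1 ?inE //= big_set1. Qed.

Lemma psum_del2 f a b W : (forall u v, f u v = f v u) -> (forall u, f u u = 0) ->
  a != b -> a \in W -> b \in W ->
  psum f W = 2 * f a b + 2 * (\sum_(c in W :\: [set a; b]) (f a c + f b c))
             + psum f (W :\: [set a; b]).
Proof.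
move=> fC f0 ab aW bW; rewrite (@psum_split f [set a; b]) //; last first.
  by apply/subsetP=> x; rewrite !inE => /orP[]/eqP->.
congr (_ + _ + _).
  by rewrite /psum !sum_set2 // !f0 (fC b a); lia.
by congr (2 * _); apply: eq_bigr => c _; rewrite sum_set2 // !(fC c).
Qed.

Lemma card_del2 a b W : a != b -> a \in W -> b \in W ->
  #|W| = #|W :\: [set a; b]| + 2.
Proof.
move=> ab aW bW; rewrite -(cardsID [set a; b] W) (setIidPr _) ?cards2 ?ab 1?addnC //.
by apply/subsetP=> x; rewrite !inE => /orP[]/eqP->.
Qed.

Lemma card_add2 u v (A B : {set V}) : u != v -> u \notin A -> v \notin A -> u \in B -> v \in B ->
  A \subset B -> #|A| + 2 <= #|B|.
Proof.
move=> uv uA vA uB vB sAB; have <- : #|u |: (v |: A)| = #|A| + 2.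
  by rewrite !cardsU1 !inE negb_or uv uA vA /= !add1n addn2.
by apply: subset_leq_card; rewrite !subUset !sub1set uB vB sAB.
Qed.

Definition clique h K := {in K &, forall u v, u != v -> h u v}.

Definition cliqueb h K := [forall u in K, forall v in K, (u != v) ==> h u v].

Lemma cliqueP h K : reflect (clique h K) (cliqueb h K).
Proof.
apply: (iffP forall_inP) => [cK u v uK vK uv|cK u uK].
  by have /forall_inP/(_ v vK)/implyP/(_ uv) := cK u uK.
by apply/forall_inP => v vK; apply/implyP; apply: cK.
Qed.

(** Turan's bound, by removal of a maximum clique: a vertex outside it misses one
    of its vertices. *)
Lemma turan_bound h (t : nat) W : symmetric h -> irreflexive h -> 0 < t ->
  (forall K, K \subset W -> clique h K -> #|K| <= t) ->
  t * psum h W <= t.-1 * (#|W| * #|W|).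
Proof.
move=> hC hI t_gt0; have [n] := ubnP #|W|; elim: n W => // n IHn W leWn Wt.
have [-> | [x xW]] := set_0Vmem W; first by rewrite /psum !big_set0 muln0.
pose P K := (K \subset W) && cliqueb h K.
have Px : P [set x].
  rewrite /P sub1set xW; apply/cliqueP => u v /set1P-> /set1P->.
  by rewrite eqxx.
case: (arg_maxnP (fun K : {set V} => #|K|) Px) => K /andP[sKW /cliqueP cK] maxK.
have K_gt0 : 0 < #|K| by have := maxK _ Px; rewrite cards1.
have Kt := Wt _ sKW cK.
have out v : v \in W :\: K -> \sum_(u in K) h v u <= #|K|.-1.
  rewrite inE => /andP[vK vW].
  have [u uK huv] : exists2 u, u \in K & ~~ h v u.
    apply/exists_inP; rewrite -negb_forall_in; apply/negP => /forall_inP hv.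
    have : P (v |: K).
      rewrite /P subUset sub1set vW sKW; apply/cliqueP => a b.
      rewrite !inE => /predU1P[->|aK] /predU1P[->|bK]; rewrite ?eqxx // => ab.
      - exact: hv.
      - by rewrite hC; apply: hv.
      - exact: cK.
    by move/maxK; rewrite cardsU1 vK /= add1n /= ltnn.
  rewrite (big_setD1 u) //= (negbTE huv) add0n.
  apply: leq_trans (_ : \sum_(i in K :\ u) 1 <= _).
    by apply: leq_sum => i _; case: (h v i).
  by rewrite sum1_card (cardsD1 u K) uK.
have inK : psum h K <= #|K| * #|K|.-1.
  rewrite -sum_nat_const.
  apply: leq_sum => u uK; rewrite (big_setD1 u) //= hI add0n.
  apply: leq_trans (_ : \sum_(i in K :\ u) 1 <= _).
    by apply: leq_sum => i _; case: (h u i).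
  by rewrite sum1_card (cardsD1 u K) uK.
have cross : \sum_(v in W :\: K) \sum_(u in K) h v u <= #|W :\: K| * #|K|.-1.
  by rewrite -sum_nat_const; apply: leq_sum => v /out.
have cW : #|W| = #|K| + #|W :\: K|.
  by rewrite -(cardsID K W) (setIidPr sKW).
have IH : t * psum h (W :\: K) <= t.-1 * (#|W :\: K| * #|W :\: K|).
  apply: IHn => [|K' sK' cK']; first by lia.
  by apply: Wt => //; apply: subset_trans sK' (subsetDl _ _).
rewrite (psum_split _ sKW); last by move=> u v; rewrite hC.
move: (psum h K) (psum h (W :\: K)) (\sum_(_ in _) _) inK cross IH K_gt0 Kt => A B C.
rewrite cW; move: #|K| #|W :\: K| t_gt0 => j r t_gt0 hA hC' hB j_gt0 jt.
case: t t_gt0 hB jt {Wt IHn} => // t _ /=; case: j j_gt0 hA hC' => // j _ /= hA hC' hB jt.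
have h1 : t.+1 * A <= t.+1 * (j.+1 * j) by rewrite leq_mul2l hA orbT.
have h2 : t.+1 * C <= t.+1 * (r * j) by rewrite leq_mul2l hC' orbT.
have hj : t.+1 * j <= t * j.+1 by lia.
have h3 : j.+1 * (t.+1 * j) <= j.+1 * (t * j.+1) by rewrite leq_mul2l hj orbT.
have h4 : r * (t.+1 * j) <= r * (t * j.+1) by rewrite leq_mul2l hj orbT.
lia.
Qed.

End PairSums.

(** * 3-graphs as symmetric ternary relations *)
Section Triples.
Variables (V : finType) (E : V -> V -> V -> bool).
Implicit Types (u v c x y z : V) (W R : {set V}).

(** Up to orderings, the size of the 3-graph on W, the size of the link of v in W and the
    codegree of u and v. *)
Definition N3 W := \sum_(x in W) psum (E x) W.
Definition lk v W := psum (E v) W.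
Definition cod u v W : nat := \sum_(z in W) E u v z.

Record trisym : Prop := Trisym {
  tri213 : forall x y z, E x y z = E y x z;
  tri132 : forall x y z, E x y z = E x z y;
  triirr : forall x z, E x x z = false }.

Hypothesis symE : trisym.

Lemma lk_del1 v u W : u \in W -> lk v W = lk v (W :\ u) + 2 * cod v u (W :\ u).
Proof.
have [E213 E132 Eirr] := symE.
move=> uW; rewrite /lk (@psum_split _ _ [set u]) ?sub1set //; last first.
  by move=> a b; rewrite E132.
have Evuu : E v u u = false by rewrite E213 E132.
rewrite /psum !big_set1 Evuu add0n addnC; congr (_ + 2 * _).
by apply: eq_bigr => c _; rewrite big_set1 E132.
Qed.

Lemma N3_del1 v W : v \in W -> N3 W = N3 (W :\ v) + 3 * lk v (W :\ v).
Proof.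
have [E213 E132 Eirr] := symE.
move=> vW; rewrite /N3 (big_setD1 v) //=.
have lkv u : lk u W = lk u (W :\ v) + 2 * cod u v (W :\ v) by apply: lk_del1.
have -> : psum (E v) W = lk v (W :\ v).
  by rewrite -/(lk v W) lkv /cod big1 ?muln0 ?addn0 // => z _; rewrite Eirr.
rewrite (eq_bigr _ (fun u _ => lkv u)).
rewrite big_split /= -big_distrr /=.
have -> : \sum_(i in W :\ v) cod i v (W :\ v) = psum (E v) (W :\ v).
  by apply: eq_bigr => u _; apply: eq_bigr => c _; rewrite E213.
by rewrite /lk; lia.
Qed.

Lemma tri_neq x y z : E x y z -> [/\ x != y, x != z & y != z].
Proof.
have [E213 E132 Eirr] := symE.
move=> Exyz; split; apply/eqP=> e; move: Exyz; rewrite e ?Eirr //.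
- by rewrite E132 Eirr.
- by rewrite E213 E132 Eirr.
Qed.

Lemma cod_del1 u v z W : z \in W -> cod u v W = E u v z + cod u v (W :\ z).
Proof. by move=> zW; rewrite /cod (big_setD1 z). Qed.

Lemma N3_del_edge x y z W : x \in W -> y \in W -> z \in W -> E x y z ->
  let R := W :\ x :\ y :\ z in
  N3 W = N3 R + 3 * (lk x R + lk y R + lk z R)
         + 6 * (cod x y R + cod x z R + cod y z R) + 6.
Proof.
move=> xW yW zW Exyz R; have [xy xz yz] := tri_neq Exyz.
rewrite (N3_del1 xW) (lk_del1 _ (_ : y \in _)) ?inE 1?eq_sym ?xy //.
rewrite (lk_del1 x (_ : z \in _)) ?inE 1?(eq_sym z) ?yz 1?(eq_sym z) ?xz //.
rewrite (cod_del1 x y (_ : z \in W :\ x :\ y)) ?inE 1?(eq_sym z) ?yz 1?(eq_sym z) ?xz //.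
rewrite (N3_del1 (_ : y \in _)) ?inE 1?(eq_sym y) ?xy //.
rewrite (lk_del1 y (_ : z \in _)) ?inE 1?(eq_sym z) ?yz 1?(eq_sym z) ?xz //.
rewrite (N3_del1 (_ : z \in _)) ?inE 1?(eq_sym z) ?yz 1?(eq_sym z) ?xz //.
rewrite -/R Exyz; lia.
Qed.

End Triples.

Lemma card_gt0P2 (V : finType) (K : {set V}) n : n < #|K| ->
  exists2 a, a \in K & n <= #|K :\ a|.
Proof.
move=> h; have /card_gt0P[a aK] : 0 < #|K| by lia.
by exists a => //; move: h; rewrite (cardsD1 a K) aK.
Qed.

Definition K4m_free (V : finType) (E : V -> V -> V -> bool) :=
  forall a b c d, E a b c -> E a b d -> E a c d -> False.

(** The alternatives are the coincidences that these four edges permit: when K4m_free holds, all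
    other pairs among a, ..., f are distinct, and six distinct vertices carry F6. *)
Definition F6_free (V : finType) (E : V -> V -> V -> bool) := forall a b c d e f,
  E a b c -> E a b d -> E c d e -> E a e f -> [\/ f = b, f = c | f = d].

(* Proves an edge from a hypothesis in which its vertices have another order. *)
Ltac edge := match goal with symE : trisym ?E |- is_true (?E _ _ _) => first
  [ assumption
  | rewrite (tri213 symE); assumption
  | rewrite (tri132 symE); assumption
  | rewrite (tri213 symE) (tri132 symE); assumption
  | rewrite (tri132 symE) (tri213 symE); assumption
  | rewrite (tri213 symE) (tri132 symE) (tri213 symE); assumption ] end.

Ltac k4 a b c d := match goal with K4 : K4m_free _ |- _ =>
  exfalso; apply: (K4 a b c d); edge end.

Section Links.
Variables (V : finType) (E : V -> V -> V -> bool).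
Hypotheses (symE : trisym E) (K4 : K4m_free E).
Implicit Types (v : V) (W : {set V}).

(** A triangle in the link of v is K_4^-, so Turan's bound applies with cliques of size two. *)
Lemma lk_mantel v W : 2 * lk E v W <= #|W| * #|W|.
Proof.
have := @turan_bound _ (E v) 2 W; rewrite mul1n; apply => //.
- by move=> x y; rewrite (tri132 symE).
- by move=> x; rewrite (tri213 symE) (tri132 symE) (triirr symE).
move=> K _ cK; rewrite leqNgt; apply/negP.
case/card_gt0P2 => a aK /card_gt0P2[b bK /card_gt0P2[c cKK _]].
move: bK cKK; rewrite !inE => /andP[ba bK] /and3P[cb ca cKK].
have h1 := cK _ _ bK aK ba; have h2 := cK _ _ cKK aK ca; have h3 := cK _ _ cKK bK cb.
by k4 v a b c.
Qed.

(** Vertices that share no edge with v are dropped before lk_mantel is used. *)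
Lemma lk_dead v (U W : {set V}) : (forall c f, c \in U -> f \in W -> ~~ E v c f) ->
  lk E v W = lk E v (W :\: U).
Proof.
move=> dead; rewrite /lk /psum.
have split (F : V -> nat) : (forall c, c \in W -> c \in U -> F c = 0) ->
    \sum_(c in W) F c = \sum_(c in W :\: U) F c.
  move=> F0; rewrite (big_setID U) /= [X in X + _]big1 // => c.
  by rewrite inE => /andP[*]; apply: F0.
rewrite split => [|c cW cU]; last first.
  by apply: big1 => f fW; rewrite (negbTE (dead _ _ cU fW)).
apply: eq_bigr => u; rewrite inE => /andP[_ uW]; apply: split => c cW cU.
by rewrite (tri132 symE) (negbTE (dead _ _ cU uW)).
Qed.

End Links.

(** * The colours of pairs with respect to an edge *)

(** The ends of a fixed edge are col 0, col 1 and col 2. The colours of a pair uv are the ends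
    that form an edge with u and v, and wt u v is their number. *)
Section Edge.
Variables (V : finType) (E : V -> V -> V -> bool).
Implicit Types (a b c d e f u v x y z : V) (W R : {set V}).

Hypotheses (symE : trisym E) (K4 : K4m_free E) (F6 : F6_free E).

Let E132 x y z : E x y z -> E x z y. Proof. by rewrite (tri132 symE). Qed.

Lemma tri_f x y : E x y y -> False.
Proof. by rewrite (tri213 symE) (tri132 symE) (triirr symE). Qed.

Variable col : 'I_3 -> V.
Hypothesis col_edge : forall i j k, i != j -> i != k -> j != k -> E (col i) (col j) (col k).

Definition out u := forall i, u <> col i.

Definition wt u v : nat := \sum_(i < 3) E (col i) u v.

Lemma third (i j : 'I_3) : i != j -> exists2 k, k != i & k != j /\
  forall l, [\/ l = i, l = j | l = k].
Proof.
have T p q r (hp : p < 3) (hq : q < 3) (hr : r < 3) : uniq [:: p; q; r] ->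
    exists2 k : 'I_3, k != Ordinal hp & k != Ordinal hq /\
      forall l, [\/ l = Ordinal hp, l = Ordinal hq | l = k].
  move=> u3; exists (Ordinal hr); last split.
  - by move: u3; rewrite /= !inE negb_or -!val_eqE /= !(eq_sym r) => /and3P[/andP[_ ->]].
  - by move: u3; rewrite /= !inE negb_or -!val_eqE /= !(eq_sym r) => /and3P[_ ->].
  move=> l; have : nat_of_ord l \in [:: p; q; r].
    by move: p q r l u3 hp hq hr {i j} => [|[|[|//]]] [|[|[|//]]] [|[|[|//]]] [[|[|[|//]]] hl].
  rewrite !inE => /or3P[]/eqP e; [constructor 1|constructor 2|constructor 3];
    exact: val_inj.
case: i j => [[|[|[|//]]] hi] [[|[|[|//]]] hj] // _.
- exact: (T 0 1 2 hi hj isT). - exact: (T 0 2 1 hi hj isT). - exact: (T 1 0 2 hi hj isT).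
- exact: (T 1 2 0 hi hj isT). - exact: (T 2 0 1 hi hj isT). - exact: (T 2 1 0 hi hj isT).
Qed.

Lemma others (k : 'I_3) : exists i j, [/\ i != j, i != k & j != k].
Proof.
have [j jk] : exists j, j != k.
  by exists (if k == ord0 then ord_max else ord0); case: (eqVneq k ord0) => [->|h]; rewrite // eq_sym.
by have [i ij [ik _]] := third jk; exists i, j.
Qed.

Lemma sum3E (F : 'I_3 -> nat) i j k : i != j -> i != k -> j != k ->
  \sum_(l < 3) F l = F i + F j + F k.
Proof.
move=> ij ik jk; rewrite (bigD1 i) //= (bigD1 j) 1?eq_sym //= (bigD1 k) /= ?big1.
- by rewrite addn0 addnA.
- move=> l /andP[/andP[li lj] lk].
  have [k' _ [_ all]] := third ij.
  have el : l = k' by case: (all l) => e //; move: li lj; rewrite e eqxx ?andbF.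
  have ek : k = k' by case: (all k) => e //; move: ik jk; rewrite e eqxx.
  by rewrite el ek eqxx in lk.
- by rewrite !(eq_sym k) ik jk.
Qed.

Lemma wtC u v : wt u v = wt v u.
Proof. by apply: eq_bigr => i _; rewrite (tri132 symE). Qed.

Lemma wt0 u : wt u u = 0.
Proof. by apply: big1 => i _; case: (boolP (E _ _ _)) => // /tri_f. Qed.

Lemma wt_gt0 u v : 0 < wt u v -> exists i, E (col i) u v.
Proof.
rewrite lt0n sum_nat_eq0 negb_forall => /existsP[i].
by rewrite eqb0 negbK; exists i.
Qed.

Lemma wt_le3 u v : wt u v <= 3.
Proof.
rewrite -[3]card_ord -sum1_card; apply: leq_sum => i _.
by case: (E _ _ _).
Qed.

Lemma wt3 i u v : wt u v = 3 -> E (col i) u v.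
Proof.
have [j [k [jk ji ki]]] := others i; rewrite /wt (sum3E _ jk ji ki).
by case: (E _ u v); case: (E _ u v); case: (E _ u v).
Qed.

Lemma wt2 u v : 2 <= wt u v -> exists i j, [/\ i != j, E (col i) u v & E (col j) u v].
Proof.
move=> w2; have [i hi] : exists i, E (col i) u v by apply: wt_gt0; lia.
move: w2; rewrite /wt (bigD1 i) //= hi.
rewrite add1n ltnS lt0n sum_nat_eq0 negb_forall => /existsP[j].
rewrite negb_imply eqb0 negbK => /andP[ji hj].
by exists i, j; rewrite eq_sym.
Qed.

(** If uv and uc share the colour i, the third side vc has no colour: for j = i this would be
    K_4^-, and otherwise the fixed edge completes the three edges to F6. *)
Lemma colour_disjoint u v c i j : out u -> out v -> out c ->
  E (col i) u v -> E (col i) u c -> E (col j) v c -> False.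
Proof.
move=> ou ov oc h1 h2 h3; have [ij|ij] := eqVneq i j.
  by subst j; k4 (col i) u v c.
have [k ki [kj _]] := third ij.
have e1 := col_edge ij (_ : i != k) (_ : j != k).
have := @F6 (col i) u v c (col j) (col k).
case; rewrite ?e1 // 1?eq_sym //; try edge.
- by move/esym/ou. - by move/esym/ov. - by move/esym/oc.
Qed.

(** The edges of u v with col i and col j, the fixed edge and an edge on u and col k form F6. *)
Lemma kill i j k u v f : i != j -> i != k -> j != k ->
  E (col i) u v -> E (col j) u v -> E u (col k) f -> [\/ f = v, f = col i | f = col j].
Proof.
move=> ij ik jk h1 h2 h3; have h4 := col_edge ij ik jk.
by apply: (@F6 u v (col i) (col j) (col k) f); edge.
Qed.

(** By colour_disjoint the side uc can only have the one colour that uv may lack, and this is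
    excluded by kill. *)
Lemma multi_no_triangle u v c : out u -> out v -> out c ->
  2 <= wt u v -> 0 < wt u c -> 0 < wt v c -> False.
Proof.
move=> ou ov oc /wt2[i [j [ij hi hj]]] /wt_gt0[l hl] /wt_gt0[l' hl'].
have [k ki [kj all]] := third ij.
have e : l = k.
  by case: (all l) => // e; subst l; exfalso;
    [apply: (@colour_disjoint u v c i l') | apply: (@colour_disjoint u v c j l')].
subst l; have h : E u (col k) c by edge.
case: (kill ij _ _ hi hj h) => [||e|e|e]; rewrite 1?eq_sym //.
- by subst c; apply: (@tri_f (col l') v).
- exact: (oc i). - exact: (oc j).
Qed.

Lemma triple_isolated u v c : out c -> wt u v = 3 -> c != v -> wt u c = 0.
Proof.
move=> oc w3 cv; apply/eqP; rewrite -leqn0 leqNgt; apply/negP=> /wt_gt0[k hk].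
have [j jk] : exists j, j != k.
  by exists (if k == ord0 then ord_max else ord0); case: (eqVneq k ord0) => [->|h]; rewrite // eq_sym.
have [i ij [ik _]] := third jk.
have h : E u (col k) c by edge.
case: (kill (k := k) ij ik jk (wt3 i w3) (wt3 j w3) h) => e.
- by rewrite e eqxx in cv. - exact: (oc i). - exact: (oc j).
Qed.

Definition dbl k u v := (wt u v == 2) && ~~ E (col k) u v.

Lemma dblC k u v : dbl k u v = dbl k v u.
Proof. by rewrite /dbl wtC (tri132 symE). Qed.

Lemma dblE i j k u v : i != j -> i != k -> j != k -> dbl k u v ->
  [/\ E (col i) u v, E (col j) u v & ~~ E (col k) u v].
Proof.
move=> ij ik jk /andP[]; rewrite /wt (sum3E _ ij ik jk).
by case: (E _ u v); case: (E _ u v); case: (E _ u v).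
Qed.

Lemma dbl_ex u v : wt u v = 2 -> exists k, dbl k u v.
Proof.
move=> w2; suff /existsP[k hk] : [exists k, ~~ E (col k) u v].
  by exists k; rewrite /dbl w2 eqxx hk.
rewrite -negb_forall; apply/negP=> /forallP h; move: w2.
rewrite /wt (eq_bigr (fun=> 1)) => [|i _]; last by rewrite h.
by rewrite sum1_card card_ord.
Qed.

(** The vertex c is joined to one end of uv only, by multi_no_triangle, and by kill it is joined
    with colours among those of uv. *)
Lemma dbl_cost k u v c : out u -> out v -> out c -> c != u -> c != v -> dbl k u v ->
  wt u c + wt v c <= 1 + (dbl k u c || dbl k v c).
Proof.
move=> ou ov oc cu cv duv.
have [i [j [ij ik jk]]] := others k; have [hi hj hk] := dblE ij ik jk duv.
have w2 : 2 <= wt u v by case/andP: duv => /eqP->.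
have one a b : out a -> out b -> c != b -> E (col i) a b -> E (col j) a b ->
    wt a c <= 1 + dbl k a c.
  move=> oa ob cb h1 h2; have nk : ~~ E (col k) a c.
    apply/negP=> h; have h' : E a (col k) c by edge.
    case: (kill ij ik jk h1 h2 h') => e; [by rewrite e eqxx in cb|exact: (oc i)|exact: (oc j)].
  rewrite /dbl nk andbT; have := sum3E (fun l => E (col l) a c : nat) ij ik jk.
  by rewrite -/(wt a c) (negbTE nk); case: (E _ a c); case: (E _ a c) => /= ->.
have := one u v ou ov cv hi hj.
have := one v u ov ou cu (E132 hi) (E132 hj).
have [-> h _|] := posnP (wt u c).
  by rewrite add0n (leq_trans h) // leq_add2l; case: (dbl k v c); rewrite ?orbT.
have [-> _ _ h|] := posnP (wt v c).
  by rewrite addn0 (leq_trans h) // leq_add2l; case: (dbl k u c).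
by move=> h1 h2; case: (@multi_no_triangle u v c).
Qed.

Definition unmet k v := [forall f, ~~ E (col k) v f].

(** By kill an edge on v and col k has its third vertex among u, col i and col j. The first
    would be a third colour of uv, and with each of the others F6 appears through c. *)
Lemma dbl2_unmet k u v c : out u -> out v -> out c -> v != c -> dbl k u v -> dbl k u c ->
  unmet k v.
Proof.
move=> ou ov oc vc duv duc; apply/forallP => f; apply/negP => hf.
have [i [j [ij ik jk]]] := others k.
have [hi hj hk] := dblE ij ik jk duv; have [ci cj ck] := dblE ij ik jk duc.
have hf' : E v (col k) f by edge.
have hkij : E (col k) (col i) (col j) by apply: col_edge; rewrite // eq_sym.
case: (kill ij ik jk (E132 hi) (E132 hj) hf') => e; subst f.
- by case/negP: hk; edge.
- case: (@F6 (col i) (col k) v (col j) u c); try edge.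
  + by move/oc. + by move/esym/eqP; apply/negP. + by move/oc.
- case: (@F6 (col j) (col k) v (col i) u c); try edge.
  + by move/oc. + by move/esym/eqP; apply/negP. + by move/oc.
Qed.

Definition o0 : 'I_3 := Ordinal (isT : 0 < 3).
Definition o1 : 'I_3 := Ordinal (isT : 1 < 3).
Definition o2 : 'I_3 := Ordinal (isT : 2 < 3).

Definition joins v : nat :=
  E v (col o0) (col o1) + E v (col o0) (col o2) + E v (col o1) (col o2).

(** Two joins of v form K_4^- with the fixed edge. *)
Lemma joins_le1 v : joins v <= 1.
Proof.
have e := col_edge (isT : o0 != o1) (isT : o0 != o2) (isT : o1 != o2).
rewrite /joins leqNgt; apply/negP => h.
have : [|| E v (col o0) (col o1) && E v (col o0) (col o2),
  E v (col o0) (col o1) && E v (col o1) (col o2) |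
  E v (col o0) (col o2) && E v (col o1) (col o2)].
  by move: h; do 3!case: (E v _ _).
case/or3P=> /andP[h1 h2].
- by k4 (col o0) v (col o1) (col o2).
- by k4 (col o1) v (col o0) (col o2).
- by k4 (col o2) v (col o0) (col o1).
Qed.

Lemma joins0 v : (forall i j, i != j -> ~ E v (col i) (col j)) -> joins v = 0.
Proof.
have F i j : i != j -> (forall i j, i != j -> ~ E v (col i) (col j)) ->
    E v (col i) (col j) = false by move=> ij h; apply/negP/h.
by move=> h; rewrite /joins !F.
Qed.

Lemma multi_no_join i j u v : i != j -> E (col i) v u -> E (col j) v u -> ~ E v (col i) (col j).
Proof. by move=> ij h1 h2 h3; k4 v u (col i) (col j). Qed.

(** Idle vertices are those that the excess weight of pairs with several colours is charged to.
    They have no joins, so each of them leaves room for one edge (idle_joins). *)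
Definition idle_at k R := [set v in R | unmet k v && [exists u in R, dbl k v u]].
Definition triple_ends R := [set v in R | [exists u in R, wt v u == 3]].
Definition idle R := #|triple_ends R| + \sum_(k < 3) #|idle_at k R|.

Lemma unmetP k v f : unmet k v -> E (col k) v f -> False.
Proof. by move=> /forallP/(_ f)/negP h /h. Qed.

Lemma idle_at_joins k R v : v \in idle_at k R -> joins v = 0.
Proof.
rewrite inE => /and3P[vR uv /exists_inP[u uR duv]]; apply: joins0 => p q pq h.
have [e|pk] := eqVneq p k; first by subst p; apply: (unmetP uv (f := col q)); edge.
have [e|qk] := eqVneq q k; first by subst q; apply: (unmetP uv (f := col p)); edge.
have [h1 h2 _] := dblE pq pk qk duv.
exact: (@multi_no_join p q u v).
Qed.

Lemma triple_ends_joins R v : v \in triple_ends R -> joins v = 0.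
Proof.
rewrite inE => /andP[vR /exists_inP[u uR /eqP w3]]; apply: joins0 => p q pq.
by apply: (@multi_no_join p q u v) => //; apply: wt3.
Qed.

Lemma idle_uniq R v : (v \in triple_ends R) + \sum_(k < 3) (v \in idle_at k R) <= 1.
Proof.
have [vt|_] := boolP (v \in triple_ends R).
  rewrite big1 // => k _; apply/eqP; rewrite eqb0; apply/negP.
  move: vt; rewrite !inE => /andP[_ /exists_inP[u _ /eqP w3]] /and3P[_ uv _].
  exact: unmetP uv (wt3 k w3).
rewrite add0n; have [/existsP[k vk]|h] := boolP [exists k, v \in idle_at k R].
  rewrite (bigD1 k) //= vk big1 ?addn0 // => l lk; apply/eqP; rewrite eqb0; apply/negP.
  move: vk; rewrite !inE => /and3P[_ uv _] /and3P[_ _ /exists_inP[u _ dl]].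
  have [i il [ik _]] := third lk.
  have ki : k != i by rewrite eq_sym.
  have kl : k != l by rewrite eq_sym.
  have [h1 _ _] := dblE ki kl il dl.
  exact: unmetP uv h1.
rewrite big1 // => k _; apply/eqP; rewrite eqb0.
by move: h; rewrite negb_exists => /forallP.
Qed.

Lemma idle_joins R : idle R + \sum_(v in R) joins v <= #|R|.
Proof.
have -> : idle R = \sum_(v in R) ((v \in triple_ends R) + \sum_(k < 3) (v \in idle_at k R)).
  have cnt (A : {set V}) : A \subset R -> #|A| = \sum_(v in R) (v \in A).
    move=> sAR; rewrite (big_setID A) /= (setIidPr sAR) [X in _ + X]big1 => [|v].
      by rewrite addn0 -sum1_card; apply: eq_bigr => v ->.
    by rewrite inE => /andP[/negbTE->].
  rewrite big_split /= exchange_big /= /idle -cnt; last by apply/subsetP=> v /setIdP[].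
  by congr (_ + _); apply: eq_bigr => k _; apply: cnt; apply/subsetP=> v /setIdP[].
rewrite -big_split -sum1_card; apply: leq_sum => v vR /=.
have := idle_uniq R v; have [/triple_ends_joins-> | _] := boolP (v \in triple_ends R); first by rewrite addn0.
have [/existsP[k /idle_at_joins->]|h] := boolP [exists k, v \in idle_at k R]; first by rewrite addn0.
move=> _; rewrite big1 ?joins_le1 // => k _; apply/eqP; rewrite eqb0.
by move: h; rewrite negb_exists => /forallP.
Qed.

Lemma sub_idle_at k R R' : R' \subset R -> idle_at k R' \subset idle_at k R.
Proof.
move=> /subsetP sR; apply/subsetP=> v; rewrite !inE.
case/and3P => /sR-> -> /exists_inP[u /sR uR duv] /=.
by apply/exists_inP; exists u.
Qed.

Lemma sub_triple_ends R R' : R' \subset R -> triple_ends R' \subset triple_ends R.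
Proof.
move=> /subsetP sR; apply/subsetP=> v; rewrite !inE.
case/andP => /sR-> /exists_inP[u /sR uR duv] /=.
by apply/exists_inP; exists u.
Qed.

Lemma idleE k R : exists2 r, idle R = r + #|idle_at k R| &
  forall R', R' \subset R -> idle R' <= r + #|idle_at k R'|.
Proof.
exists (#|triple_ends R| + \sum_(l < 3 | l != k) #|idle_at l R|).
  by rewrite /idle (bigD1 k) //= addnCA addnC.
move=> R' sR; rewrite /idle (bigD1 k) //= addnCA addnC leq_add2r leq_add ?subset_leq_card ?sub_triple_ends //.
by apply: leq_sum => l _; rewrite subset_leq_card ?sub_idle_at.
Qed.

(** * Removal of the pairs with several colours *)
Lemma triple_del u v R : {in R, forall c, out c} -> u \in R -> v \in R -> wt u v = 3 ->
  psum wt R = psum wt (R :\: [set u; v]) + 6 /\ #|triple_ends (R :\: [set u; v])| + 2 <= #|triple_ends R|.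
Proof.
move=> oR uR vR w3; have w3' : wt v u = 3 by rewrite wtC.
have uv : u != v by apply/eqP=> e; move: w3; rewrite e wt0.
split; last first.
  apply: (card_add2 uv); rewrite ?sub_triple_ends ?subsetDl // !inE ?eqxx ?orbT // ?uR ?vR /=.
    by apply/exists_inP; exists v => //; apply/eqP.
  by apply/exists_inP; exists u => //; apply/eqP.
rewrite (psum_del2 wtC wt0 uv uR vR) w3 big1 => [|c]; first by rewrite muln0 addn0 addnC.
rewrite !inE negb_or => /andP[/andP[cu cv] cR].
by rewrite (triple_isolated (oR _ cR) w3 cv) (triple_isolated (oR _ cR) w3' cu).
Qed.

Section Deletion.
(** True if a pair with two colours may span C5 with the fixed edge. *)
Variable zeta : bool.
Hypothesis C5_zeta : forall a b i j k, i != j -> i != k -> j != k -> out a -> out b ->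
  E (col i) a b -> E (col j) a b -> E a (col k) (col i) -> E b (col k) (col j) -> zeta.

(** The two outcomes of the removal of a pair with several colours from R. In drop1 the weight
    corrected by the idle vertices loses at most |R| - 1, or |R| when zeta holds. In drop2 it
    may lose in addition as much as the number of vertices idle at k, but two of these
    disappear, so this outcome gets cheaper each time. *)
Definition drop1 R R' :=
  psum wt R + 2 * idle R' + 2 <= psum wt R' + 2 * idle R + 2 * #|R| + 2 * zeta.

Definition drop2 k R R' :=
  psum wt R + 2 * idle R' + 8 <= psum wt R' + 2 * idle R + 2 * #|R| + 2 * #|idle_at k R| /\
  #|idle_at k R'| + 2 <= #|idle_at k R|.

Definition twins k u v R := [set c in R :\: [set u; v] | dbl k u c || dbl k v c].

Lemma dbl_del k u v R : {in R, forall c, out c} -> u \in R -> v \in R -> dbl k u v ->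
  psum wt R + 0 <= psum wt (R :\: [set u; v]) + 2 * #|R| + 2 * #|twins k u v R|.
Proof.
move=> oR uR vR duv; have uv : u != v by apply/eqP=> e; move: duv; rewrite /dbl e wt0.
rewrite (psum_del2 wtC wt0 uv uR vR) (card_del2 uv uR vR).
have [/eqP-> _] := andP duv.
have : \sum_(c in R :\: [set u; v]) (wt u c + wt v c) <=
    #|R :\: [set u; v]| + #|twins k u v R|.
  rewrite -!sum1_card [X in _ <= _ + X](eq_bigl (fun c => (c \in R :\: [set u; v]) &&
    (dbl k u c || dbl k v c))); last by move=> c; rewrite inE.
  rewrite [X in _ <= _ + X]big_mkcondr -big_split /=; apply: leq_sum => c.
  rewrite !inE negb_or => /andP[/andP[cu cv] cR].
  by apply: dbl_cost => //; apply: oR.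
by lia.
Qed.

Lemma sub_twins k u v R : {in R, forall c, out c} -> u \in R -> v \in R -> dbl k u v ->
  twins k u v R \subset idle_at k R.
Proof.
move=> oR uR vR duv; apply/subsetP => c; rewrite !inE negb_or.
case/andP=> /andP[/andP[cu cv] cR]; rewrite cR /= => /orP[] d.
- rewrite (dbl2_unmet (oR _ uR) (oR _ cR) (oR _ vR) cv d duv).
  by apply/exists_inP; exists u; rewrite // dblC.
- rewrite dblC in duv.
  rewrite (dbl2_unmet (oR _ vR) (oR _ cR) (oR _ uR) cu d duv).
  by apply/exists_inP; exists v; rewrite // dblC.
Qed.

(** When u forms an edge with col k, its partners have no partner but u, by dbl2_unmet. They all
    cease to be idle at k together with v, and this pays for them. *)
Lemma star_del k u v R : {in R, forall c, out c} -> u \in R -> v \in R -> dbl k u v ->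
  ~~ unmet k u -> twins k u v R != set0 -> drop1 R (R :\: [set u; v]).
Proof.
move=> oR uR vR duv Nu /set0Pn[c0 c0C]; set C := twins _ _ _ _ in c0C *.
have uv : u != v by apply/eqP=> e; move: duv; rewrite /dbl e wt0.
have dvu : dbl k v u by rewrite dblC.
have Cu c : c \in C -> [/\ c != u, c != v, c \in R & dbl k u c].
  rewrite !inE negb_or => /andP[/andP[/andP[cu cv] cR] /orP[//|d]].
  case/negP: Nu; apply: (dbl2_unmet (oR _ vR) (oR _ uR) (oR _ cR) _ dvu d).
  by rewrite eq_sym.
have [c0u c0v c0R dc0] := Cu _ c0C.
have Uv : unmet k v.
  by apply: (dbl2_unmet (oR _ uR) (oR _ vR) (oR _ c0R) _ duv dc0); rewrite eq_sym.
have [r rE rle] := idleE k R.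
have le1 := rle _ (subsetDl R [set u; v]).
have : #|idle_at k (R :\: [set u; v])| + #|C| + 1 <= #|idle_at k R|.
  have -> : #|idle_at k (R :\: [set u; v])| + #|C| + 1 =
      #|v |: (idle_at k (R :\: [set u; v]) :|: C)|.
    rewrite cardsU1 cardsU !inE !eqxx !orbT /= add1n addn1; congr _.+1.
    rewrite (_ : _ :&: _ = set0) ?cards0 ?subn0 //; apply/setP => c; rewrite [RHS]inE.
    apply/setIP => -[h /Cu[cu cv cR dc]]; move: h.
    rewrite inE => /and3P[_ _ /exists_inP[d]]; rewrite !inE negb_or => /andP[/andP[du dv] dR] dcd.
    case/negP: Nu; apply: (dbl2_unmet (oR _ cR) (oR _ uR) (oR _ dR) _ _ dcd).
      by rewrite eq_sym.
    by rewrite dblC.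
  apply: subset_leq_card; rewrite !subUset sub1set sub_idle_at ?subsetDl // sub_twins // !andbT.
  by rewrite inE vR Uv; apply/exists_inP; exists u.
have := dbl_del oR uR vR duv; rewrite -/C /drop1 rE; move: le1.
by clear; lia.
Qed.

(** For a pair uv that lacks the colour k, without twins: if both ends formed an edge with col k,
    then kill would leave only edges that make K_4^- or C5, so one end is idle at k unless zeta
    holds, and this end pays. With twins, star_del applies unless both ends are unmet by col k;
    then the twins are also idle at k, which bounds their number. *)
Lemma multi_del u v R : {in R, forall c, out c} -> u \in R -> v \in R -> 2 <= wt u v ->
  drop1 R (R :\: [set u; v]) \/ exists k, drop2 k R (R :\: [set u; v]).
Proof.
move=> oR uR vR w2.
have uv : u != v by apply/eqP=> e; move: w2; rewrite e wt0.
have sR' := subsetDl R [set u; v].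
have m2 := card_del2 uv uR vR.
have [w3|wn3] := eqVneq (wt u v) 3.
  left; have [e tr] := triple_del oR uR vR w3.
  have pr : \sum_(k < 3) #|idle_at k (R :\: [set u; v])| <= \sum_(k < 3) #|idle_at k R|.
    by apply: leq_sum => k _; rewrite subset_leq_card ?sub_idle_at.
  by rewrite /drop1 /idle m2 e; move: tr pr; clear; lia.
have {wn3}w2 : wt u v = 2 by have := wt_le3 u v; lia.
have [k duv] := dbl_ex w2; have dvu : dbl k v u by rewrite dblC.
have le := dbl_del oR uR vR duv.
have [r rE rle] := idleE k R; have le1 := rle _ sR'.
have sub := subset_leq_card (sub_idle_at k sR').
have tC : twins k v u R = twins k u v R.
  by apply/setP => c; rewrite !inE (orbC (c == v)) (orbC (dbl k v c)).
have dC : [set v; u] = [set u; v] by rewrite setUC.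
have [C0|Cn0] := eqVneq (twins k u v R) set0.
  left; move: le; rewrite /drop1 C0 cards0.
  have [zT|/negbTE z0] := boolP zeta; first by rewrite rE; move: le1 sub; clear; lia.
  have lose x y : [set u; v] = [set x; y] -> x \in R -> y \in R -> dbl k x y -> unmet k x ->
      #|idle_at k (R :\: [set u; v])| + 1 <= #|idle_at k R|.
    move=> e xR yR dxy Ux; rewrite e.
    have -> : #|idle_at k (R :\: [set x; y])| + 1 = #|x |: idle_at k (R :\: [set x; y])|.
      by rewrite cardsU1 !inE eqxx /= addnC.
    apply: subset_leq_card; rewrite subUset sub1set sub_idle_at ?subsetDl // andbT inE xR Ux.
    by apply/exists_inP; exists y.
  suff : unmet k u || unmet k v.
    by case/orP=> U; [have := lose u v erefl uR vR duv U|have := lose v u (esym dC) vR uR dvu U];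
      rewrite rE; move: le1; clear; lia.
  rewrite -[_ || _]negbK negb_or; apply/negP=> /andP[/forallPn[f /negbNE hf] /forallPn[f' /negbNE hf']].
  have [i [j [ij ik jk]]] := others k; have [hi hj hk] := dblE ij ik jk duv.
  have kf : E u (col k) f by edge.
  have kf' : E v (col k) f' by edge.
  have ji : j != i by rewrite eq_sym.
  have := kill ij ik jk hi hj kf; have := kill ij ik jk (E132 hi) (E132 hj) kf'.
  case=> e; subst f'; first by case/negP: hk; edge.
    case=> e; subst f; first by case/negP: hk; edge.
      by k4 (col i) u v (col k).
    have := C5_zeta ij ik jk (oR _ vR) (oR _ uR) (E132 hi) (E132 hj) kf' kf.
    by rewrite z0.
  case=> e; subst f; first by case/negP: hk; edge.
    have := C5_zeta ij ik jk (oR _ uR) (oR _ vR) hi hj kf kf'.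
    by rewrite z0.
  by k4 (col j) u v (col k).
have [Uu|Nu] := boolP (unmet k u); last by left; apply: (star_del oR uR vR duv Nu Cn0).
have [Uv|Nv] := boolP (unmet k v); last first.
  by left; rewrite -dC; apply: (star_del (k := k)) => //; rewrite tC.
right; exists k.
have pu : u \in idle_at k R by rewrite inE uR Uu; apply/exists_inP; exists v.
have pv : v \in idle_at k R by rewrite inE vR Uv; apply/exists_inP; exists u.
have loss : #|idle_at k (R :\: [set u; v])| + 2 <= #|idle_at k R|.
  by apply: (card_add2 uv); rewrite ?sub_idle_at // !inE eqxx ?orbT.
have tw : #|twins k u v R| + 2 <= #|idle_at k R|.
  by apply: (card_add2 uv); rewrite ?sub_twins // !inE eqxx ?orbT.
by split=> //; rewrite rE; move: le le1 loss tw; clear; lia.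
Qed.

Definition noK4 R := forall K : {set V}, K \subset R -> clique (fun u v => 0 < wt u v) K -> #|K| <= 3.

Lemma noK4_sub R R' : R' \subset R -> noK4 R -> noK4 R'.
Proof. by move=> sR h K sK; apply: h; apply: subset_trans sR. Qed.

Lemma out_sub R R' : R' \subset R -> {in R, forall c, out c} -> {in R', forall c, out c}.
Proof. by move=> /subsetP sR h c /sR/h. Qed.

Lemma simple_turan R : noK4 R -> {in R &, forall u v, wt u v <= 1} ->
  3 * psum wt R <= 2 * (#|R| * #|R|).
Proof.
move=> nk w1; have := @turan_bound _ (fun u v => 0 < wt u v) 3 R _ _ isT nk.
have -> : psum (fun u v => 0 < wt u v) R = psum wt R.
  apply: eq_bigr => u uR; apply: eq_bigr => v vR; have := w1 u v uR vR.
  by case: (wt u v) => [|[|]].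
by apply=> [u v|u]; rewrite ?wt0 // wtC.
Qed.

Lemma ord3 (k : 'I_3) : [\/ k = o0, k = o1 | k = o2].
Proof.
case: k => [[|[|[|//]]] hk]; [constructor 1|constructor 2|constructor 3]; exact: val_inj.
Qed.

(** The removals are repeated until Turan's theorem for cliques of size three applies. Here x_k
    counts the outcomes drop2 k and y the outcomes drop1, and the inequality is three times the
    sum of all losses; the term 6 * (x_k * x_k) records that drop2 gets cheaper. *)
Lemma peel R : {in R, forall c, out c} -> noK4 R -> exists x0 x1 x2 y : nat,
  let k := x0 + x1 + x2 + y in
  [/\ 2 * k <= #|R|,
     [/\ 2 * x0 <= #|idle_at o0 R|, 2 * x1 <= #|idle_at o1 R| & 2 * x2 <= #|idle_at o2 R|],
     k = 0 -> {in R &, forall u v, wt u v <= 1} &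
     3 * psum wt R + 2 * (k * #|R|) + 6 * (x0 * x0 + x1 * x1 + x2 * x2)
       + 18 * (x0 + x1 + x2) + 6 * y
     <= 2 * (#|R| * #|R|) + 2 * (k * k) + 6 * k
       + 6 * (x0 * #|idle_at o0 R| + x1 * #|idle_at o1 R| + x2 * #|idle_at o2 R|)
       + 6 * idle R + 6 * (zeta * y)].
Proof.
have [n] := ubnP #|R|; elim: n R => // n IHn R ltRn oR nk.
have [/exists_inP[u uR /exists_inP[v vR w2]]|simple] :=
    boolP [exists u in R, [exists v in R, 2 <= wt u v]]; last first.
  have w1 : {in R &, forall u v, wt u v <= 1}.
    move=> u v uR vR; rewrite leqNgt; apply: contra simple => w2.
    by apply/exists_inP; exists u => //; apply/exists_inP; exists v.
  exists 0, 0, 0, 0; split=> //.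
  by have := simple_turan nk w1; move: (psum _ _) (idle _) #|R|; clear; lia.
have uv : u != v by apply/eqP=> e; move: w2; rewrite e wt0.
have m2 := card_del2 uv uR vR; have sR := subsetDl R [set u; v].
have := multi_del oR uR vR w2.
have [|x0 [x1 [x2 [y]]]] := IHn _ _ (out_sub sR oR) (noK4_sub sR nk).
  by move: ltRn m2; clear; lia.
have l0 := subset_leq_card (sub_idle_at o0 sR).
have l1 := subset_leq_card (sub_idle_at o1 sR).
have l2 := subset_leq_card (sub_idle_at o2 sR).
move: (R :\: _) m2 l0 l1 l2 {IHn ltRn w2 uR vR uv sR nk oR} => R' m2 l0 l1 l2 /=.
move=> [k2 [b0 b1 b2] _ ineq] drop.
have le0 : x0 * #|idle_at o0 R'| <= x0 * #|idle_at o0 R| by rewrite leq_mul2l l0 orbT.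
have le1 : x1 * #|idle_at o1 R'| <= x1 * #|idle_at o1 R| by rewrite leq_mul2l l1 orbT.
have le2 : x2 * #|idle_at o2 R'| <= x2 * #|idle_at o2 R| by rewrite leq_mul2l l2 orbT.
case: drop => [d1|[k [d2 loss]]].
  exists x0, x1, x2, y.+1; move: d1; rewrite /drop1.
  split; [|split|by rewrite addnS|]; [move: k2 m2; clear; lia|
    move: b0 l0; clear; lia|move: b1 l1; clear; lia|move: b2 l2; clear; lia|].
  move: ineq le0 le1 le2 d1; rewrite m2; clear.
  by move: (psum _ R) (psum _ R') (idle R) (idle R') #|R'| => *; lia.
case: (ord3 k) => e; subst k.
- have le0' : x0 * #|idle_at o0 R'| + 2 * x0 <= x0 * #|idle_at o0 R|.
    by rewrite (mulnC 2) -mulnDr leq_mul2l loss orbT.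
  exists x0.+1, x1, x2, y.
  split; [|split|by rewrite !addSn|]; [move: k2 m2; clear; lia|
    move: b0 loss; clear; lia|move: b1 l1; clear; lia|move: b2 l2; clear; lia|].
  move: ineq le0' le1 le2 d2; rewrite m2; clear.
  by move: (psum _ R) (psum _ R') (idle R) (idle R') #|R'| => *; lia.
- have le1' : x1 * #|idle_at o1 R'| + 2 * x1 <= x1 * #|idle_at o1 R|.
    by rewrite (mulnC 2) -mulnDr leq_mul2l loss orbT.
  exists x0, x1.+1, x2, y.
  split; [|split|by rewrite addnS !addSn|]; [move: k2 m2; clear; lia|
    move: b0 l0; clear; lia|move: b1 loss; clear; lia|move: b2 l2; clear; lia|].
  move: ineq le0 le1' le2 d2; rewrite m2; clear.
  by move: (psum _ R) (psum _ R') (idle R) (idle R') #|R'| => *; lia.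
- have le2' : x2 * #|idle_at o2 R'| + 2 * x2 <= x2 * #|idle_at o2 R|.
    by rewrite (mulnC 2) -mulnDr leq_mul2l loss orbT.
  exists x0, x1, x2.+1, y.
  split; [|split|by rewrite addnS !addSn|]; [move: k2 m2; clear; lia|
    move: b0 l0; clear; lia|move: b1 l1; clear; lia|move: b2 loss; clear; lia|].
  move: ineq le0 le1 le2' d2; rewrite m2; clear.
  by move: (psum _ R) (psum _ R') (idle R) (idle R') #|R'| => *; lia.
Qed.

End Deletion.

(** The link of col k avoids a third of W, so it is small by Mantel's theorem, and col k can be
    removed. *)
Lemma low_unmet k W (U : {set V}) : col k \in W -> U \subset W :\ col k ->
  {in U, forall c, unmet k c} -> #|W| <= 3 * #|U| -> 4 < #|W| ->
  N3 E (W :\ col k) <= 6 * (s3 #|W|.-1 + (#|W|.-1 == 5)) ->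
  N3 E W < 6 * s3 #|W|.
Proof.
move=> kW sU unc U3 n5 IH.
have cW := cardsD1 (col k) W; rewrite kW add1n in cW.
rewrite (N3_del1 symE kW); set n := #|W|.-1 in IH *.
have nE : #|W| = n.+1 by rewrite /n cW.
have dead c f : c \in U -> f \in W :\ col k -> ~~ E (col k) c f.
  by move=> cU _; apply/negP => h; apply: (unmetP (unc _ cU) (f := f)); edge.
rewrite (lk_dead symE dead); set Q := _ :\: U.
have cQ : #|Q| = n - #|U|.
  by rewrite /Q cardsD (setIidPr sU) /n cW.
have := lk_mantel symE K4 (col k) Q.
have U3' : n.+1 <= 3 * #|U| by rewrite -nE.
have n4 : 4 <= n by move: n5; rewrite nE.
have := @s3_low n (lk E (col k) Q) #|Q| n4.
rewrite nE cQ; move: IH U3'; move: (lk _ _ _) (N3 _ _) #|U| => l N u IH U3' h1 h2.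
have h3 : 3 * (n - u) + 1 <= 2 * n by move: U3' n4; clear; lia.
have := h1 h2 h3; move: IH; clear; lia.
Qed.

(** * The 5-cycle *)
Definition cyc5 p0 p1 p2 p3 p4 :=
  [/\ E p0 p1 p2, E p1 p2 p3, E p2 p3 p4, E p3 p4 p0 & E p4 p0 p1].

Lemma cyc5_rot p0 p1 p2 p3 p4 : cyc5 p0 p1 p2 p3 p4 -> cyc5 p1 p2 p3 p4 p0.
Proof. by case. Qed.

Lemma cyc5_chord p0 p1 p2 p3 p4 c : cyc5 p0 p1 p2 p3 p4 -> c != p1 -> c != p2 -> c != p4 ->
  E c p0 p3 = false.
Proof.
case=> h0 h1 h2 h3 h4 /eqP c1 /eqP c2 /eqP c4; apply/negP => h.
by case: (@F6 p0 p1 p4 p2 p3 c); try edge.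
Qed.

Lemma cyc5_side_side p0 p1 p2 p3 p4 c : cyc5 p0 p1 p2 p3 p4 ->
  E c p0 p1 -> E c p1 p2 -> False.
Proof. by case=> h0 h1 h2 h3 h4 h h'; k4 p1 p0 p2 c. Qed.

Lemma cyc5_side_far p0 p1 p2 p3 p4 c : cyc5 p0 p1 p2 p3 p4 -> c != p4 ->
  E c p0 p1 -> E c p2 p3 -> False.
Proof.
case=> h0 h1 h2 h3 h4 /eqP c4 h h'.
have [_ p41 _] := tri_neq symE h4; have [_ p24 _] := tri_neq symE h2.
case: (@F6 p0 p1 p2 c p3 p4); try edge => //.
- by move/eqP; apply/negP. - by move/esym/eqP; apply/negP.
- by move/esym.
Qed.

(** An edge of c with a pair at distance two on the cycle gives F6, two edges with adjacent sides
    give K_4^-, and two edges with the other pairs of sides give F6. *)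
Lemma cyc5_meet p0 p1 p2 p3 p4 c : cyc5 p0 p1 p2 p3 p4 ->
  uniq [:: c; p0; p1; p2; p3; p4] ->
  E c p0 p1 + E c p1 p2 + E c p2 p3 + E c p3 p4 + E c p4 p0
  + (E c p0 p2 + E c p1 p3 + E c p2 p4 + E c p3 p0 + E c p4 p1) <= 1.
Proof.
move=> q0 /andP[]; rewrite !inE !negb_or => /and5P[c0 c1 c2 c3 c4] _.
have q1 := cyc5_rot q0; have q2 := cyc5_rot q1; have q3 := cyc5_rot q2; have q4 := cyc5_rot q3.
have d0 := cyc5_chord q0 c1 c2 c4; have d1 := cyc5_chord q1 c2 c3 c0.
have d2 := cyc5_chord q2 c3 c4 c1; have d3 := cyc5_chord q3 c4 c0 c2.
have d4 := cyc5_chord q4 c0 c1 c3.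
rewrite (tri132 symE c p3 p0) d0 (tri132 symE c p4 p1) d1 (tri132 symE c p0 p2) d2.
rewrite (tri132 symE c p1 p3) d3 (tri132 symE c p2 p4) d4.
have := cyc5_side_side (c := c) q0; have := cyc5_side_side (c := c) q1.
have := cyc5_side_side (c := c) q2; have := cyc5_side_side (c := c) q3.
have := cyc5_side_side (c := c) q4; have := cyc5_side_far q0 c4; have := cyc5_side_far q1 c0.
have := cyc5_side_far q2 c1; have := cyc5_side_far q3 c2; have := cyc5_side_far q4 c3.
by do 5!case: (E c _ _) => //=; intuition.
Qed.

(** A bound by one per pair in place of the 2 / 3 of Turan's theorem, good enough for a small R. By
    dbl_cost a pair with two colours has at most two units of weight with each other vertex. *)
Lemma sparse_psum R : {in R, forall c, out c} -> psum wt R <= #|R| * #|R| + 2 * #|triple_ends R|.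
Proof.
have [n] := ubnP #|R|; elim: n R => // n IHn R ltRn oR.
have [/exists_inP[u uR /exists_inP[v vR w2]]|simple] :=
    boolP [exists u in R, [exists v in R, 2 <= wt u v]]; last first.
  apply: leq_trans (leq_addr _ _); rewrite -sum_nat_const; apply: leq_sum => u uR.
  rewrite -sum1_card; apply: leq_sum => v vR.
  rewrite leqNgt; apply: contra simple => w2.
  by apply/exists_inP; exists u => //; apply/exists_inP; exists v.
have uv : u != v by apply/eqP=> e; move: w2; rewrite e wt0.
have m2 := card_del2 uv uR vR; have sR := subsetDl R [set u; v].
have /= := IHn _ _ (out_sub sR oR); rewrite m2 in ltRn *.
have lt' : #|R :\: [set u; v]| < n by move: ltRn; clear; lia.
move=> /(_ lt').
have tsub := subset_leq_card (sub_triple_ends sR).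
have [w3|wn3] := eqVneq (wt u v) 3.
  by have [-> tr] := triple_del oR uR vR w3; move: tr; clear; lia.
rewrite (psum_del2 wtC wt0 uv uR vR).
have {wn3}w2 : wt u v = 2 by have := wt_le3 u v; lia.
have [k duv] := dbl_ex w2.
have : \sum_(c in R :\: [set u; v]) (wt u c + wt v c) <= 2 * #|R :\: [set u; v]|.
  rewrite mulnC -sum_nat_const; apply: leq_sum => c.
  rewrite !inE negb_or => /andP[/andP[cu cv] cR].
  apply: leq_trans (dbl_cost (oR _ uR) (oR _ vR) (oR _ cR) cu cv duv) _.
  by case: (_ || _).
by rewrite w2; move: tsub; clear; lia.
Qed.

Lemma joinsE i j k c : i != j -> i != k -> j != k ->
  joins c = E c (col i) (col j) + E c (col i) (col k) + E c (col j) (col k).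
Proof.
have C p q : E c (col p) (col q) = E c (col q) (col p) by rewrite (tri132 symE).
rewrite /joins; case: (ord3 i) (ord3 j) (ord3 k) => [] -> [] -> [] -> // _ _ _;
  rewrite ?(C o1 o0) ?(C o2 o0) ?(C o2 o1); by clear; lia.
Qed.

(** * The induction step at an edge *)
Section Step.
Variable W : {set V}.
Hypothesis colW : forall k, col k \in W.
Let R := W :\ col o0 :\ col o1 :\ col o2.

Let e012 : E (col o0) (col o1) (col o2). Proof. exact: col_edge. Qed.

Lemma outR c : c \in R -> out c.
Proof.
rewrite !inE => /and4P[c2 c1 c0 _] k; case: (ord3 k) => -> /eqP; exact/negP.
Qed.

Lemma card_R : #|W| = #|R| + 3.
Proof.
have [xy xz yz] := tri_neq symE e012.
rewrite (cardsD1 (col o0)) colW (cardsD1 (col o1)) (cardsD1 (col o2)) -/R.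
by rewrite !inE !colW !(eq_sym (col o1)) !(eq_sym (col o2)) xy xz yz /=; lia.
Qed.

Lemma R_proper : R \proper W.
Proof.
apply/andP; split; last by apply/subsetPn; exists (col o0); rewrite ?inE ?eqxx ?andbF.
by do 2!apply: subset_trans (subsetDl _ _) _; apply: subsetDl.
Qed.

Lemma N3_edge : N3 E W = N3 E R + 3 * psum wt R + 6 * (\sum_(c in R) joins c) + 6.
Proof.
rewrite (N3_del_edge symE (colW o0) (colW o1) (colW o2) e012) -/R.
have -> : psum wt R = lk E (col o0) R + lk E (col o1) R + lk E (col o2) R.
  rewrite /lk -!psumD; apply: eq_bigr => u _; apply: eq_bigr => v _.
  by rewrite /wt (sum3E _ (isT : o0 != o1) (isT : o0 != o2) (isT : o1 != o2)).
congr (_ + 6 * _ + _); rewrite /cod -!big_split; apply: eq_bigr => c _ /=.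
have rot x y : E c x y = E x y c by rewrite (tri213 symE c) (tri132 symE x).
by rewrite /joins !(rot (col _)).
Qed.

Lemma idle_at_low k R' : R' \subset R -> #|W| <= 3 * #|idle_at k R'| -> 4 < #|W| ->
  N3 E (W :\ col k) <= 6 * (s3 #|W|.-1 + (#|W|.-1 == 5)) -> N3 E W < 6 * s3 #|W|.
Proof.
move=> /subsetP sR; apply: low_unmet => //.
  apply/subsetP=> v; rewrite inE => /andP[/sR vR _].
  have ov := outR vR; move: vR; rewrite !inE => /and4P[_ _ _ ->]; rewrite andbT.
  exact/eqP/ov.
by move=> v; rewrite inE => /and3P[].
Qed.

(** The three parts of N3_edge are bounded by the induction hypothesis, by idle_joins and by
    peel_bound0, and the bounds add up to s3_add3. A pair with several colours makes the last
    one strict; otherwise equality in N3_edge leaves no vertex without a join. *)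
Lemma step_noC5 :
  (forall a b i j k, i != j -> i != k -> j != k -> out a -> out b ->
     E (col i) a b -> E (col j) a b -> E a (col k) (col i) -> E b (col k) (col j) -> false) ->
  noK4 R -> (forall W', W' \proper W -> N3 E W' <= 6 * s3 #|W'|) ->
  [/\ N3 E W <= 6 * s3 #|W|,
      5 < #|W| -> (exists u v, [/\ u \in R, v \in R & 2 <= wt u v]) -> N3 E W < 6 * s3 #|W| &
      N3 E W = 6 * s3 #|W| -> {in R &, forall u v, wt u v <= 1} ->
        {in R, forall c, joins c = 1}].
Proof.
move=> noC5 nk IH; have cW := card_R.
have eqgap : N3 E W = 6 * s3 #|W| -> {in R &, forall u v, wt u v <= 1} ->
    {in R, forall c, joins c = 1}.
  move=> eN w1 c cR; have g1 : \sum_(v in R) joins v <= #|R|.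
    by rewrite -sum1_card; apply: leq_sum => v _; apply: joins_le1.
  have t1 := simple_turan nk w1.
  have IHR := IH _ R_proper.
  have gR : #|R| <= \sum_(v in R) joins v.
    have := square_div3 #|R|; move: eN; rewrite N3_edge cW s3_add3; move: IHR t1.
    by clear; lia.
  have := joins_le1 c; case e0: (joins c) => [|[|]] // _; move: gR.
  rewrite (big_setD1 c) //= e0 add0n (cardsD1 c) cR.
  suff : \sum_(v in R :\ c) joins v <= #|R :\ c| by clear; lia.
  by rewrite -sum1_card; apply: leq_sum => v _; apply: joins_le1.
have [/existsP[k lek]|/existsPn small] := boolP [exists k, #|W| <= 3 * #|idle_at k R|].
  have lt : N3 E W < 6 * s3 #|W|.
    apply: (idle_at_low (subxx _) lek).
      have : #|idle_at k R| <= #|R| by apply: subset_leq_card; apply/subsetP=> v /setIdP[].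
      by move: lek; rewrite cW; clear; lia.
    have cD := cardsD1 (col k) W; rewrite colW add1n in cD.
    by rewrite cD /= mulnDr (leq_trans (IH _ (properD1 (colW k)))) // leq_addr.
  exact: And3 (ltnW lt) (fun _ _ => lt) eqgap.
have {}small k : 3 * #|idle_at k R| <= #|R| + 2.
  by have := small k; rewrite -ltnNge cW; clear; lia.
have [x0 [x1 [x2 [y /= [k2 _ k0 ineq]]]]] :=
  @peel false noC5 R (fun c => @outR c) nk.
(* Without C5 the hypothesis on zeta holds for zeta = false, and the term with y vanishes. *)
have [b1 b2] : _ /\ _ := peel_bound0 k2 (small o0) (small o1) (small o2)
  (leq_trans ineq (eq_leq (addn0 _))).
have IHR := IH _ R_proper.
have ig := idle_joins R; have sq := square_div3 #|R|.
split=> //.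
  by rewrite N3_edge cW s3_add3; move: IHR b1 ig sq; clear; lia.
move=> n6 [u [v [uR vR w2]]].
have kpos : 0 < x0 + x1 + x2 + y.
  by rewrite lt0n; apply/eqP => /k0/(_ _ _ uR vR); rewrite leqNgt w2.
have := b2 kpos _; rewrite cW in n6 *; rewrite s3_add3 N3_edge.
by move: IHR ig sq n6; clear; lia.
Qed.

(** The pair ab spans C5 with the fixed edge. By cyc5_meet each vertex c of the rest R2 has at most
    one unit of weight with a and b and of joins together, in place of one unit of each.
    This gain beats the cost of zeta in peel; for small R2, sparse_psum replaces peel. *)
Lemma step_C5 a b i j k :
  i != j -> i != k -> j != k -> a \in R -> b \in R ->
  E (col i) a b -> E (col j) a b -> E a (col k) (col i) -> E b (col k) (col j) ->
  noK4 R -> (forall W', W' \proper W -> N3 E W' <= 6 * (s3 #|W'| + (#|W'| == 5))) ->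
  if #|W| == 5 then N3 E W <= 30 else N3 E W < 6 * s3 #|W|.
Proof.
move=> ij ik jk aR bR h1 h2 h3 h4 nk IH; have cW := card_R.
have oa := outR aR; have ob := outR bR.
have ab : a != b by apply/eqP=> e; move: h1; rewrite e => /tri_f.
have wab : wt a b = 2.
  rewrite /wt (sum3E _ ij ik jk) h1 h2; case: (boolP (E (col k) a b)) => // h.
  by k4 a b (col k) (col i).
have C : cyc5 b a (col i) (col k) (col j).
  have e := col_edge ij ik jk; split; edge.
have sub2 := subsetDl R [set a; b]; have m2 := card_del2 ab aR bR.
set R2 := R :\: [set a; b] in sub2 m2.
have oR2 : {in R2, forall c, out c} by move=> c /(subsetP sub2)/outR.
have local c : c \in R2 -> wt a c + wt b c + joins c + (c \in triple_ends R2) <= 1.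
  move=> cR2; have oc := oR2 _ cR2.
  have [ca cb] : c != a /\ c != b by move: cR2; rewrite !inE negb_or => /andP[/andP[]].
  have [ct|_] := boolP (c \in triple_ends R2).
    rewrite (triple_ends_joins ct); move: ct; rewrite inE => /andP[_ /exists_inP[d dR2 /eqP w3]].
    have [da db] : d != a /\ d != b by move: dR2; rewrite !inE negb_or => /andP[/andP[]].
    by rewrite wtC (triple_isolated oa w3) 1?eq_sym // wtC (triple_isolated ob w3) 1?eq_sym.
  have := @cyc5_meet b a (col i) (col k) (col j) c C _.
  rewrite /wt !(sum3E _ ij ik jk) (joinsE c ij ik jk).
  have rot l v : E (col l) v c = E c v (col l).
    by rewrite (tri213 symE) (tri132 symE) (tri213 symE).
  rewrite !rot !(tri132 symE c (col _) b).
  rewrite (tri132 symE c (col k) (col j)) (tri132 symE c (col j) a).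
  have colN p q : p != q -> col p != col q.
    move=> pq; have [r rp [rq _]] := third pq.
    by have [] := tri_neq symE (col_edge pq (_ : p != r) (_ : q != r)); rewrite // eq_sym.
  have u6 : uniq [:: c; b; a; col i; col k; col j].
    have kj : k != j by rewrite eq_sym.
    rewrite /= !inE !negb_or ca cb (eq_sym b) ab (colN _ _ ik) (colN _ _ ij) (colN _ _ kj) /= !andbT.
    have N x l : out x -> x != col l by move=> ox; apply/eqP/ox.
    by rewrite !N.
  by move=> /(_ u6); move: (E c) => F; clear; lia.
have sumR : \sum_(c in R2) (wt a c + wt b c) + \sum_(c in R2) joins c + #|triple_ends R2| <= #|R2|.
  have -> : #|triple_ends R2| = \sum_(c in R2) (c \in triple_ends R2).
    rewrite (big_setID (triple_ends R2)) /= (setIidPr _); last by apply/subsetP=> c /setIdP[].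
    rewrite [X in _ + X]big1 => [|c]; last by rewrite inE => /andP[/negbTE->].
    by rewrite addn0 -sum1_card; apply: eq_bigr => c ->.
  rewrite -!big_split -sum1_card; apply: leq_sum => c cR2 /=; exact: local.
have gapR : \sum_(c in R) joins c <= 2 + \sum_(c in R2) joins c.
  rewrite (big_setID [set a; b]) /= leq_add2r (setIidPr _) ?sum_set2 //.
    by have := joins_le1 a; have := joins_le1 b; clear; lia.
  by rewrite subUset !sub1set aR bR.
have NR := IH _ R_proper.
have NW : N3 E W <= 6 * (s3 #|R| + (#|R| == 5)) + 30 + 6 * #|R2| + 3 * psum wt R2
    - 6 * #|triple_ends R2|.
  rewrite N3_edge (psum_del2 wtC wt0 ab aR bR) -/R2 wab.
  by move: NR sumR gapR; clear; lia.
have le_trip : #|triple_ends R2| <= #|R2| by apply/subset_leq_card/subsetP=> c /setIdP[].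
have s1 := sparse_psum oR2.
have [n5|n5] := eqVneq #|W| 5.
  have r0 : #|R2| = 0 by move: n5; rewrite cW m2; clear; lia.
  have s30 : s3 (0 + 2) = 0 by [].
  by move: NW s1 le_trip; rewrite m2 r0 s30; clear; lia.
have r_gt0 : 0 < #|R2| by rewrite lt0n; apply: contra n5 => /eqP r0; rewrite cW m2 r0.
(* Up to seven vertices the bound of sparse_psum is enough, by direct evaluation of s3. *)
have [r7|r8] := leqP #|R2| 7.
  rewrite cW s3_add3 m2; move: NW; rewrite m2; move: s1 r_gt0 r7 le_trip; clear.
  move: (psum _ _) (N3 _ _) #|triple_ends _| => p N t.
  by case: #|R2| => [|[|[|[|[|[|[|[|r]]]]]]]] //; rewrite /= => *; lia.
have [/existsP[l lel]|/existsPn small] := boolP [exists l, #|W| <= 3 * #|idle_at l R2|].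
  apply: (idle_at_low sub2 lel); first by move: r8; rewrite cW m2; clear; lia.
  have cD := cardsD1 (col l) W; rewrite colW add1n in cD.
  by rewrite cD /=; apply: IH; apply: properD1.
have {}small l : 3 * #|idle_at l R2| <= #|R2| + 4.
  by have := small l; rewrite -ltnNge cW m2; clear; lia.
have [x0 [x1 [x2 [y /= [k2 _ _ ineq]]]]] :=
  @peel true (fun _ _ _ _ _ _ _ _ _ _ _ _ _ _ => isT) R2 oR2 (noK4_sub sub2 nk).
have b1 := peel_bound1 k2 (small o0) (small o1) (small o2)
  (leq_trans ineq (eq_leq (congr1 (addn _) (congr1 (muln 6) (mul1n y))))).
have ig := idle_joins R2; have sq := square_div3 (#|R2| + 2).
rewrite cW s3_add3 m2; move: NW; rewrite m2; move: b1 ig sq r8 le_trip; clear; lia.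
Qed.

End Step.

End Edge.

(** * Fano planes *)

(** The points of the Fano plane are the nonzero vectors of the space of dimension three over the
    field with two elements, and i, j, vadd i j are the points of a line. *)
Definition vec := (bool * bool * bool)%type.
Definition vadd (i j : vec) : vec := (i.1.1 (+) j.1.1, i.1.2 (+) j.1.2, i.2 (+) j.2).
Definition vzero : vec := (false, false, false).

Lemma vaddC i j : vadd i j = vadd j i.
Proof. by case: i j => [[[] []] []] [[[] []] []]. Qed.
Lemma vaddA i j k : vadd i (vadd j k) = vadd (vadd i j) k.
Proof.
by case: i j k => [[a b] c] [[a' b'] c'] [[a'' b''] c'']; congr (_, _, _) => /=; rewrite addbA.
Qed.
Lemma vaddK i j : vadd (vadd i j) j = i.
Proof. by case: i j => [[[] []] []] [[[] []] []]. Qed.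
Lemma vadd_eq0 i j : (vadd i j == vzero) = (i == j).
Proof. by case: i j => [[[] []] []] [[[] []] []]. Qed.
Lemma vadd_eqr i j : (vadd i j == i) = (j == vzero).
Proof. by case: i j => [[[] []] []] [[[] []] []]. Qed.
Lemma vadd_eql i j : (vadd i j == j) = (i == vzero).
Proof. by rewrite vaddC vadd_eqr. Qed.
Lemma vadd_inj i j k : (vadd i j == vadd i k) = (j == k).
Proof. by rewrite -vadd_eq0 vaddA (vaddC i j) vaddK vadd_eq0. Qed.

(** A plane has index two. For points this says that any two lines of the Fano plane meet. *)
Lemma vadd_coset i j k l : i != vzero -> j != vzero -> i != j ->
  k \notin [:: vzero; i; j; vadd i j] -> l \notin [:: vzero; i; j; vadd i j] ->
  vadd k l \in [:: vzero; i; j; vadd i j].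
Proof.
pose vecs := [seq (x, c) | x <- [seq (a, b) | a <- [:: true; false], b <- [:: true; false]],
  c <- [:: true; false]].
have mem (x : vec) : x \in vecs by case: x => [[[] []] []].
have H : all (fun i => all (fun j => all (fun k => all (fun l =>
  [&& i != vzero, j != vzero, i != j, k \notin [:: vzero; i; j; vadd i j] &
    l \notin [:: vzero; i; j; vadd i j]] ==> (vadd k l \in [:: vzero; i; j; vadd i j]))
  vecs) vecs) vecs) vecs by vm_compute.
move=> i0 j0 ij kP lP; move/allP/(_ i (mem _))/allP/(_ j (mem _)): H.
move/allP/(_ k (mem _))/allP/(_ l (mem _))/implyP; apply.
by apply/and5P.
Qed.

Lemma card_vec : #|[set i : vec | i != vzero]| = 7.
Proof.
have := cardsC1 vzero; rewrite !card_prod card_bool /= => <-.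
by apply: eq_card => i; rewrite !inE.
Qed.

Lemma sum_pred_le1 (T : finType) (A : {set T}) (F : T -> bool) :
  {in A &, forall x y, F x -> F y -> x = y} -> \sum_(x in A) F x <= 1.
Proof.
move=> h; have -> : \sum_(x in A) F x = #|[set x in A | F x]|.
  by rewrite -sum1_card big_mkcond [RHS]big_mkcond; apply: eq_bigr => x _;
    rewrite inE; case: (x \in A); case: (F x).
apply/card_le1_eqP => x y; rewrite !inE => /andP[xA Fx] /andP[yA Fy].
exact: h.
Qed.

Section Fano.
Variables (V : finType) (E : V -> V -> V -> bool).
Implicit Types (a b c d e f u v w x y z : V) (i j k l t : vec) (W R K : {set V}).

Hypotheses (symE : trisym E) (K4 : K4m_free E) (F6 : F6_free E).

Variable pt : vec -> V.
Hypothesis line : forall i j, i != vzero -> j != vzero -> i != j ->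
  E (pt i) (pt j) (pt (vadd i j)).

Lemma pt_inj i j : i != vzero -> j != vzero -> pt i = pt j -> i = j.
Proof.
move=> i0 j0 e; apply/eqP/negPn/negP => ij.
by have [] := tri_neq symE (line i0 j0 ij); rewrite e eqxx.
Qed.

Definition off u := forall i, i != vzero -> u <> pt i.

(** The colours of a pair are now the points of the plane that form an edge with it. *)
Definition cw u v : nat := \sum_(i | i != vzero) E (pt i) u v.

Lemma cwC u v : cw u v = cw v u.
Proof. by apply: eq_bigr => i _; rewrite (tri132 symE). Qed.

(** As colour_disjoint, with the line through i and j in the part of the fixed edge. *)
Lemma fano_disjoint u v c i j : off u -> off v -> off c -> i != vzero -> j != vzero ->
  E (pt i) u v -> E (pt i) u c -> E (pt j) v c -> False.
Proof.
move=> ou ov oc i0 j0 h1 h2 h3; have [ij|ij] := eqVneq i j.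
  by subst j; k4 (pt i) u v c.
have h4 := line i0 j0 ij; have k0 : vadd i j != vzero by rewrite vadd_eq0.
case: (@F6 (pt i) u v c (pt j) (pt (vadd i j))); try edge.
- by move/esym/(ou _ k0). - by move/esym/(ov _ k0). - by move/esym/(oc _ k0).
Qed.

Lemma fano_kill u v f i j : i != vzero -> j != vzero -> i != j ->
  E (pt i) u v -> E (pt j) u v -> E u (pt (vadd i j)) f ->
  [\/ f = v, f = pt i | f = pt j].
Proof.
move=> i0 j0 ij h1 h2 h3; have h4 := line i0 j0 ij.
by apply: (@F6 u v (pt i) (pt j) (pt (vadd i j)) f); edge.
Qed.

Lemma kill_off u v c i j : off c -> i != vzero -> j != vzero -> i != j ->
  E (pt i) u v -> E (pt j) u v -> E (pt (vadd i j)) u c -> c = v.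
Proof.
move=> oc i0 j0 ij h1 h2 h3; have h4 : E u (pt (vadd i j)) c by edge.
by case: (fano_kill i0 j0 ij h1 h2 h4) => // /oc[].
Qed.

(** If t is on the line through i and j this is K_4^-; otherwise the line through t and the third
    point of that line completes F6. *)
Lemma fano_matching_off t i j w : t != vzero -> i != vzero -> j != vzero ->
  t != i -> t != j -> i != j -> off w -> E (pt t) (pt i) w -> E (pt t) (pt j) w -> False.
Proof.
move=> t0 i0 j0 ti tj ij ow h1 h2; have h3 := line i0 j0 ij.
have e0 : vadd i j != vzero by rewrite vadd_eq0.
have [e|te] := eqVneq t (vadd i j).
  by rewrite -e in h3; k4 (pt t) w (pt i) (pt j).
have h4 := line t0 e0 te; have f0 : vadd t (vadd i j) != vzero by rewrite vadd_eq0.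
case: (@F6 (pt t) w (pt i) (pt j) (pt (vadd i j)) (pt (vadd t (vadd i j)))); try edge.
- by move/esym/(ow _ f0).
- move/(pt_inj f0 i0)/eqP; rewrite (vaddC i) vaddA vadd_eql vadd_eq0.
  by rewrite (negbTE tj).
- by move/(pt_inj f0 j0)/eqP; rewrite vaddA vadd_eql vadd_eq0 (negbTE ti).
Qed.

Lemma fano_line_only t i l : t != vzero -> i != vzero -> l != vzero ->
  E (pt t) (pt i) (pt l) -> l = vadd t i.
Proof.
move=> t0 i0 l0 h; apply/eqP/negPn/negP => lN.
have [ti tl il] := tri_neq symE h.
have {}ti : t != i by apply: contraNneq ti => ->.
have {}tl : t != l by apply: contraNneq tl => ->.
have {}il : i != l by apply: contraNneq il => ->.
have h1 := line t0 i0 ti; have q0 : vadd t i != vzero by rewrite vadd_eq0.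
have ql : vadd t i != l by rewrite eq_sym.
have h2 := line q0 l0 ql; have e0 : vadd (vadd t i) l != vzero by rewrite vadd_eq0.
have te : t != vadd (vadd t i) l.
  by rewrite -vaddA eq_sym vadd_eqr vadd_eq0.
have h3 := line t0 e0 te; have f0 : vadd t (vadd (vadd t i) l) != vzero by rewrite vadd_eq0.
have fE : vadd t (vadd (vadd t i) l) = vadd i l.
  by rewrite -vaddA vaddC (vaddC t) vaddK.
case: (@F6 (pt t) (pt i) (pt (vadd t i)) (pt l) (pt (vadd (vadd t i) l))
  (pt (vadd t (vadd (vadd t i) l)))); try edge.
- by move/(pt_inj f0 i0)/eqP; rewrite fE vadd_eqr (negbTE l0).
- by move/(pt_inj f0 q0)/eqP; rewrite fE (vaddC t) vadd_inj eq_sym (negbTE tl).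
- by move/(pt_inj f0 l0)/eqP; rewrite fE vadd_eql (negbTE i0).
Qed.

(** By fano_kill the ends of such a pair form no other edge with pt t, so they lie in the set
    unmet_in t W below. These sets replace the idle vertices of the case of one edge. *)
Definition missing_sum t u v :=
  ~~ E (pt t) u v &&
  [exists i, [&& i != vzero, i != t, E (pt i) u v & E (pt (vadd t i)) u v]].

Definition holds_line u v := [exists i, exists j, [&& i != vzero, j != vzero, i != j,
  E (pt i) u v, E (pt j) u v & E (pt (vadd i j)) u v]].

Lemma cw_le7 u v : cw u v <= 7.
Proof.
rewrite -card_vec -sum1_card /cw big_mkcond [X in _ <= X]big_mkcond; apply: leq_sum => i _.
by rewrite inE; case: (i != _) => //; case: (E _ _ _).
Qed.

(** When no line consists of colours, the sums of one colour with each of the others are missing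
    sums. *)
Lemma cw_excess u v :
  cw u v <= (0 < cw u v) + \sum_(t | t != vzero) missing_sum t u v + 6 * holds_line u v.
Proof.
have [->|cpos] := posnP (cw u v) => //.
have [fT|nfull] := boolP (holds_line u v); first by have := cw_le7 u v; clear; lia.
have [i0 i00 Pi0] : exists2 i0, i0 != vzero & E (pt i0) u v.
  move: cpos; rewrite lt0n sum_nat_eq0 negb_forall => /existsP[i0].
  by rewrite negb_imply eqb0 negbK => /andP[]; exists i0.
rewrite /cw (bigD1 i0) //= Pi0 muln0 addn0 leq_add2l.
(* The colours other than i0 are written as i0 + t. *)
rewrite (reindex_inj (h := vadd i0)); last by move=> i j /eqP; rewrite vadd_inj => /eqP.
rewrite (eq_bigl (fun t => (t != vzero) && (t != i0))) => [|t]; last first.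
  by rewrite vadd_eq0 vadd_eqr andbC (eq_sym i0).
rewrite [X in _ <= X](bigID (fun t => t != i0)) /=.
apply: leq_trans (leq_addr _ _); apply: leq_sum => t /andP[t0 ti].
case: (boolP (E (pt (vadd i0 t)) u v)) => // h; rewrite lt0b.
apply/andP; split.
  apply: contra nfull => h'; apply/existsP; exists i0; apply/existsP; exists t.
  by rewrite i00 t0 (eq_sym i0) ti Pi0 h' h.
by apply/existsP; exists i0; rewrite i00 (eq_sym i0) ti Pi0 (vaddC t) h.
Qed.

Definition unmet_in t W := [set u in W | [forall f in W, ~~ E (pt t) u f]].

Lemma missing_sumC t u v : missing_sum t u v = missing_sum t v u.
Proof.
have C i : E (pt i) u v = E (pt i) v u by rewrite (tri132 symE).
by rewrite /missing_sum C; congr (_ && _); apply: eq_existsb => i; rewrite !C.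
Qed.

Lemma missing_sum_unmet t W u v : {in W, forall c, off c} -> t != vzero -> u \in W -> v \in W ->
  missing_sum t u v -> u \in unmet_in t W.
Proof.
move=> oW t0 uW vW /andP[nt /existsP[i /and4P[i0 it h1 h2]]].
rewrite inE uW; apply/forall_inP => f fW; apply: contra nt => h.
have ti0 : vadd t i != vzero by rewrite vadd_eq0 eq_sym.
have ne : i != vadd t i by rewrite eq_sym vadd_eql.
have e : vadd i (vadd t i) = t by rewrite vaddC vaddK.
have := kill_off (oW _ fW) i0 ti0 ne h1 h2; rewrite e => /(_ _)/= <- //.
Qed.

(** The pairs that join u to the rest of K have disjoint sets of colours, by fano_disjoint. *)
Lemma clique_colours (A : pred vec) q u K : {in K, forall c, off c} ->
  clique (fun u v => 0 < cw u v) K -> u \in K ->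
  {in K :\ u, forall c, q <= \sum_(i | (i != vzero) && A i) E (pt i) u c} ->
  #|K :\ u| * q <= #|[set i | (i != vzero) && A i]|.
Proof.
move=> oK cK uK qle; rewrite -sum_nat_const (leq_trans (leq_sum _ qle)) //.
rewrite exchange_big /= -sum1_card; under [X in _ <= X]eq_bigl do rewrite inE.
apply: leq_sum => i /andP[i0 _]; apply: sum_pred_le1 => c d.
rewrite !inE => /andP[cu cK'] /andP[du dK'] h1 h2; apply/eqP/negPn/negP => cd.
have := cK _ _ cK' dK' cd.
rewrite lt0n sum_nat_eq0 negb_forall => /existsP[j].
rewrite negb_imply eqb0 negbK => /andP[j0 h3].
exact: (fano_disjoint (oK _ uK) (oK _ cK') (oK _ dK') i0 j0 h1 h2 h3).
Qed.

Lemma cw_clique K : {in K, forall c, off c} -> clique (fun u v => 0 < cw u v) K -> #|K| <= 8.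
Proof.
move=> oK cK; have [->|[u uK]] := set_0Vmem K; first by rewrite cards0.
have := @clique_colours xpredT 1 u K oK cK uK; rewrite muln1 => h.
rewrite (cardsD1 u) uK (leq_ltn_trans (h _)) //.
  move=> c; rewrite !inE => /andP[cu cK']; have := cK _ _ uK cK'.
  by rewrite eq_sym => /(_ cu); rewrite /cw; under [in X in _ -> X]eq_bigl do rewrite andbT.
by under eq_finset do rewrite andbT; rewrite card_vec.
Qed.

Lemma missing_sum_clique t K : t != vzero -> {in K, forall c, off c} ->
  clique (missing_sum t) K -> #|K| <= 4.
Proof.
move=> t0 oK cK; have [->|[u uK]] := set_0Vmem K; first by rewrite cards0.
have two a b : missing_sum t a b -> 2 <= \sum_(i | (i != vzero) && (i != t)) E (pt i) a b.
  case/andP=> _ /existsP[i /and4P[i0 it h1 h2]].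
  rewrite (bigD1 i) ?i0 //= h1 (bigD1 (vadd t i)) /= ?h2 //.
  by rewrite vadd_eq0 (eq_sym t) it vadd_eqr i0 vadd_eql t0.
have sub : #|[set i | (i != vzero) && (i != t)]| = 6.
  have := card_vec; rewrite (cardsD1 t) inE t0 => -[<-]; apply: eq_card => i.
  by rewrite !inE andbC.
have := @clique_colours (fun i => i != t) 2 u K oK _ uK _; rewrite sub => h.
rewrite (cardsD1 u K) uK.
suff : #|K :\ u| * 2 <= 6 by clear; lia.
apply: h => [a b aK bK ab|c]; last first.
  by rewrite !inE => /andP[cu cK']; apply/two/cK; rewrite // eq_sym.
have := two _ _ (cK _ _ aK bK ab); rewrite /cw => h.
apply: leq_trans (_ : \sum_(i | (i != vzero) && (i != t)) E (pt i) a b <= _).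
  by move: h; clear; lia.
by rewrite [X in _ <= X](bigID (fun i => i != t)) /= leq_addr.
Qed.

Lemma psum_restrict (f : V -> V -> nat) W K : K \subset W ->
  (forall u v, f u v = f v u) ->
  {in W &, forall u v, u \notin K -> f u v = 0} -> psum f W = psum f K.
Proof.
move=> sK fC f0; rewrite (psum_split fC sK) /psum [X in _ + _ + X]big1 => [|u]; last first.
  by rewrite inE => /andP[uK uW]; apply: big1 => v /setDP[vW _]; apply: f0.
rewrite [X in 2 * X]big1 ?addn0 // => u /setDP[uW uK]; apply: big1 => v vK.
by apply: f0 => //; apply: (subsetP sK).
Qed.

(** Given u, there is at most one such v: if uc also has a line of colours, the two lines meet,
    and a common colour is a sum of two colours of uv, so that c = v by kill_off. *)
Lemma psum_holds_line W : {in W, forall c, off c} -> psum holds_line W <= #|W|.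
Proof.
move=> oW; rewrite /psum -sum1_card; apply: leq_sum => u uW.
apply: sum_pred_le1 => v c vW cW.
case/existsP=> i /existsP[j /and5P[i0 j0 ij h1 /andP[h2 h3]]].
case/existsP=> k /existsP[l /and5P[k0 l0 kl g1 /andP[g2 g3]]].
apply/eqP/negPn/negP => /eqP vc.
have ne p : p != vzero -> E (pt p) u c -> p \notin [:: vzero; i; j; vadd i j].
  move=> p0 gp; rewrite !inE (negbTE p0) /=; apply/negP => /or3P[]/eqP e; subst p; apply: vc.
  - have ij0 : vadd i j != vzero by rewrite vadd_eq0.
    have n : j != vadd i j by rewrite eq_sym vadd_eql.
    by apply/esym/(kill_off (oW _ cW) j0 ij0 n h2 h3); rewrite (vaddC j) vaddK.
  - have ij0 : vadd i j != vzero by rewrite vadd_eq0.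
    have n : i != vadd i j by rewrite eq_sym vadd_eqr.
    by apply/esym/(kill_off (oW _ cW) i0 ij0 n h1 h3); rewrite (vaddC i) (vaddC i) vaddK.
  - exact/esym/(kill_off (oW _ cW) i0 j0 ij h1 h2).
have kl0 : vadd k l != vzero by rewrite vadd_eq0.
have := ne _ kl0 g3; rewrite vadd_coset //; exact: ne.
Qed.

(** Turan's theorem for the coloured pairs, with cliques of size at most 8, and for each t for
    the pairs with missing sum t, with cliques of size at most 4. *)
Lemma psum_colours W : {in W, forall c, off c} ->
  8 * psum cw W <= 7 * (#|W| * #|W|) + 48 * #|W| +
    6 * \sum_(t | t != vzero) #|unmet_in t W| * #|unmet_in t W|.
Proof.
move=> oW; have offS (K : {set V}) : K \subset W -> {in K, forall c, off c}.
  by move=> /subsetP sK c /sK/oW.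
have irr t u : missing_sum t u u = false.
  apply/negP=> /andP[_ /existsP[i /and4P[_ _ h _]]].
  by have [_ _] := tri_neq symE h; rewrite eqxx.
have irr' u : (0 < cw u u) = false.
  apply/negbTE; rewrite -eqn0Ngt; apply/eqP/big1 => i _; apply/eqP; rewrite eqb0.
  by apply/negP=> h; have [_ _] := tri_neq symE h; rewrite eqxx.
have b1 : 8 * psum (fun u v => 0 < cw u v) W <= 7 * (#|W| * #|W|).
  apply: (@turan_bound _ (fun u v => 0 < cw u v) 8 W) => // [u v|K sK cK].
    by rewrite cwC.
  by apply: cw_clique cK; apply: offS.
have b2 t : t != vzero -> 4 * psum (missing_sum t) W <= 3 * (#|unmet_in t W| * #|unmet_in t W|).
  move=> t0; have sC : unmet_in t W \subset W by apply/subsetP=> u /setIdP[].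
  rewrite (psum_restrict sC) => [|u v|u v uW vW]; last first.
  - apply: contraNeq; rewrite eqb0 negbK; exact: missing_sum_unmet.
  - by rewrite missing_sumC.
  apply: (@turan_bound _ (missing_sum t) 4 (unmet_in t W)) => // [u v|K sK cK]; first by rewrite missing_sumC.
  by apply: (missing_sum_clique t0) cK; apply: offS; apply: subset_trans sC.
have b3 := psum_holds_line oW.
have : psum cw W <= psum (fun u v => 0 < cw u v) W +
    \sum_(t | t != vzero) psum (missing_sum t) W + 6 * psum holds_line W.
  have -> : \sum_(t | t != vzero) psum (missing_sum t) W =
      psum (fun u v => \sum_(t | t != vzero) missing_sum t u v) W.
    by rewrite /psum exchange_big; apply: eq_bigr => u _; rewrite exchange_big.
  have -> : 6 * psum holds_line W = psum (fun u v => 6 * holds_line u v) W.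
    by rewrite /psum big_distrr; apply: eq_bigr => u _; rewrite big_distrr.
  by rewrite -!psumD; apply: leq_psum => u v _ _; apply: cw_excess.
have : 4 * \sum_(t | t != vzero) psum (missing_sum t) W <=
    3 * \sum_(t | t != vzero) #|unmet_in t W| * #|unmet_in t W|.
  by rewrite !big_distrr; apply: leq_sum => t /b2.
by move: b1 b3; clear; lia.
Qed.

Section Degrees.
Variable W0 : {set V}.
Hypothesis ptW : forall i, i != vzero -> pt i \in W0.
Let S := [set pt i | i in [set i | i != vzero]].
Let W := W0 :\: S.

Let offW : {in W, forall c, off c}.
Proof.
move=> c /setDP[_ /imsetP cS] i i0 e; case: cS; exists i; by rewrite ?inE.
Qed.

Let card_W : #|W0| = #|W| + 7.
Proof.
have sS : S \subset W0 by apply/subsetP=> x /imsetP[i i0 ->]; rewrite inE in i0; apply: ptW.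
rewrite -(cardsID S) (setIidPr sS) addnC card_in_imset ?card_vec // => i j.
by rewrite !inE; apply: pt_inj.
Qed.

Let inS t u : u \in (W0 :\ pt t) :\: W -> exists i, [/\ i != vzero, i != t & u = pt i].
Proof.
rewrite !inE negb_and negbK => /andP[uS /andP[ut uW]]; rewrite uW orbF in uS.
have [i i0 e] := imsetP uS; rewrite inE in i0; exists i; split=> //.
by apply: contraNneq ut => <-; rewrite e.
Qed.

(** Besides the pairs in W, the link of pt t has the six ordered pairs from the three lines
    through t, and at most one pair of a point with each vertex of W. *)
Lemma fano_degree t : t != vzero ->
  lk E (pt t) (W0 :\ pt t) <= psum (E (pt t)) W + 2 * #|W| + 6.
Proof.
move=> t0; have sW : W \subset W0 :\ pt t.
  apply/subsetP=> c cW; rewrite inE (subsetP (subsetDl _ _) _ cW) andbT inE.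
  by apply/eqP; apply: offW.
rewrite /lk (@psum_split _ (E (pt t)) W) //; last by move=> u v; rewrite (tri132 symE).
have c6 : #|(W0 :\ pt t) :\: W| = 6.
  have := cardsD1 (pt t) W0; rewrite ptW // -(cardsID W (W0 :\ pt t)) (setIidPr sW).
  by rewrite card_W; clear; lia.
have cross : \sum_(u in (W0 :\ pt t) :\: W) \sum_(v in W) E (pt t) u v <= #|W|.
  rewrite exchange_big /= -sum1_card; apply: leq_sum => v vW.
  apply: sum_pred_le1 => _ _ /inS[i [i0 it ->]] /inS[j [j0 jt ->]] h1 h2.
  congr pt; apply/eqP/negPn/negP => ij.
  by apply: (@fano_matching_off t i j v) => //; rewrite 1?eq_sym //; apply: offW.
have inner : psum (E (pt t)) ((W0 :\ pt t) :\: W) <= 6.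
  rewrite -c6 -sum1_card; apply: leq_sum => _ /inS[i [i0 it ->]].
  apply: sum_pred_le1 => _ _ /inS[j [j0 jt ->]] /inS[k [k0 kt ->]] h1 h2.
  by rewrite (fano_line_only t0 i0 j0 h1) (fano_line_only t0 i0 k0 h2).
by rewrite leq_add // leq_add2l leq_mul2l cross.
Qed.

(** Otherwise the degrees of all seven points are at least s3 n - s3 (n - 1), hence at least
    (n - 1)^2 / 9 by s3_succ. If about a third of W is unmet by some point, this contradicts
    Mantel's theorem in its link; if there is no such point, the sum of the degrees is too large
    for psum_colours. *)
Lemma fano_lt : {in W0, forall v, N3 E (W0 :\ v) <= 6 * s3 #|W0|.-1} ->
  N3 E W0 < 6 * s3 #|W0|.
Proof.
move=> IH; rewrite ltnNge; apply/negP => big.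
set m := #|W|.
have nE : #|W0| = (m + 6).+1 by rewrite card_W addnS.
have low t : t != vzero -> 2 * ((m + 6) * (m + 6)) <= 9 * lk E (pt t) (W0 :\ pt t).
  move=> t0; have := IH _ (ptW t0); move: big; rewrite (N3_del1 symE (ptW t0)) nE /=.
  have m1 : 1 < m + 6 by rewrite addnC.
  by have := s3_succ m1; clear; lia.
have dead t : psum (E (pt t)) W = lk E (pt t) (W :\: unmet_in t W).
  apply: (lk_dead symE) => c f; rewrite inE => /andP[_ /forall_inP h]; exact: h.
have [/exists_inP[t t0 tbig]|/exists_inPn small] :=
    boolP [exists t in [pred t | t != vzero], m <= 3 * #|unmet_in t W| + 2].
  have := fano_degree t0; have := low _ t0; rewrite dead.
  have := lk_mantel symE K4 (pt t) (W :\: unmet_in t W).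
  have sC : unmet_in t W \subset W by apply/subsetP=> u /setIdP[].
  rewrite cardsD (setIidPr sC) -/m.
  have : 3 * (m - #|unmet_in t W|) <= 2 * m + 2 by move: tbig; clear; lia.
  move: (m - _) => q h1 h2 h3 h4.
  have h5 : 3 * q * (3 * q) <= (2 * m + 2) * (2 * m + 2) by apply: leq_mul.
  by move: h1 h2 h3 h4 h5; clear; lia.
have sml t : t != vzero -> 9 * (#|unmet_in t W| * #|unmet_in t W|) + 6 * m <= m * m + 9.
  move=> t0; have := small t t0; rewrite -ltnNge => h.
  have m3 : 3 <= m by move: h; clear; lia.
  have h5 : 3 * #|unmet_in t W| * (3 * #|unmet_in t W|) <= (m - 3) * (m - 3).
    by apply: leq_mul; move: h; clear; lia.
  have -> : m = m - 3 + 3 by rewrite subnK.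
  by move: h5; move: (m - 3) #|_|; clear; lia.
have c7 (r : nat) : 7 * r = \sum_(t | t != vzero) r.
  by rewrite -card_vec -sum_nat_const; apply: eq_bigl => t; rewrite inE.
have S1 : 7 * (2 * ((m + 6) * (m + 6))) <= 9 * \sum_(t | t != vzero) lk E (pt t) (W0 :\ pt t).
  by rewrite c7 big_distrr /=; apply: leq_sum => t /low.
have S2 : \sum_(t | t != vzero) lk E (pt t) (W0 :\ pt t) <= psum cw W + 7 * (2 * m + 6).
  have -> : psum cw W = \sum_(t | t != vzero) psum (E (pt t)) W.
    by rewrite /psum [RHS]exchange_big; apply: eq_bigr => u _; rewrite [RHS]exchange_big.
  by rewrite c7 -big_split /=; apply: leq_sum => t /fano_degree; rewrite addnA.
have S3 : 9 * \sum_(t | t != vzero) #|unmet_in t W| * #|unmet_in t W| + 7 * (6 * m) <= 7 * (m * m + 9).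
  by rewrite !c7 big_distrr -big_split /=; apply: leq_sum => t /sml.
have S4 := psum_colours offW.
by move: S1 S2 S3 S4; rewrite -/m; clear; lia.
Qed.

End Degrees.

End Fano.

(** * 3-graphs without C5 *)
Section Assembly.
Variables (V : finType) (E : V -> V -> V -> bool).
Implicit Types (a b c d e f u v w x y z : V) (W R K : {set V}).

Hypotheses (symE : trisym E) (K4 : K4m_free E) (F6 : F6_free E).

Definition fano_in W := exists2 pt : vec -> V,
  forall i j, i != vzero -> j != vzero -> i != j -> E (pt i) (pt j) (pt (vadd i j)) &
  forall i, i != vzero -> pt i \in W.

Section OneEdge.
Variable col : 'I_3 -> V.
Hypothesis col_edge : forall i j k, i != j -> i != k -> j != k -> E (col i) (col j) (col k).
Variable W : {set V}.
Hypothesis colW : forall k, col k \in W.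

(** By colour_disjoint adjacent sides of the clique have disjoint colours, so opposite sides have
    the same single colour. The three ends and the four vertices are then the points of a Fano
    plane: with a as the vector (0, 0, 1), the other vertices are a + col i, a + col j and
    a + col k. *)
Lemma K4_fano K : K \subset W -> {in K, forall c, out col c} ->
  clique (fun u v => 0 < wt E col u v) K -> 3 < #|K| -> fano_in W.
Proof.
move=> /subsetP sK oK cK /card_gt0P2[a aK /card_gt0P2[b bK /card_gt0P2[c cK' /card_gt0P2[d dK _]]]].
move: bK cK' dK; rewrite !inE => /andP[ba bK] /and3P[cb ca cK'] /and4P[dc db da dK].
have ex u v : u \in K -> v \in K -> u != v -> exists i, E (col i) u v.
  by move=> uK vK uv; apply: wt_gt0; apply: cK.
have dis u v w i j : u \in K -> v \in K -> w \in K -> v != w ->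
    E (col i) u v -> E (col j) u w -> i != j.
  move=> uK vK wK vw h1 h2; apply/eqP => e; subst j.
  have [l hl] := ex _ _ vK wK vw.
  exact: (colour_disjoint symE K4 F6 col_edge (oK _ uK) (oK _ vK) (oK _ wK) h1 h2 hl).
have ab : a != b by rewrite eq_sym.
have ac : a != c by rewrite eq_sym.
have ad : a != d by rewrite eq_sym.
have bc : b != c by rewrite eq_sym.
have bd : b != d by rewrite eq_sym.
have cd : c != d by rewrite eq_sym.
have [i hab] := ex _ _ aK bK ab; have [j hac] := ex _ _ aK cK' ac; have [k had] := ex _ _ aK dK ad.
have ij := dis _ _ _ _ _ aK bK cK' bc hab hac.
have ik := dis _ _ _ _ _ aK bK dK bd hab had.
have jk := dis _ _ _ _ _ aK cK' dK cd hac had.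
have third l : l != i -> l != j -> l = k.
  move=> li lj; have [k' k'i [k'j all]] := third ij.
  have ek : k = k' by case: (all k) => // e; rewrite e eqxx in ik jk.
  by rewrite ek; case: (all l) => // e; rewrite e eqxx in li lj.
have third' l : l != i -> l != k -> l = j.
  by move=> li lk; apply/eqP/negPn/negP => lj; rewrite (third l li lj) eqxx in lk.
have third'' l : l != j -> l != k -> l = i.
  by move=> lj lk; apply/eqP/negPn/negP => li; rewrite (third l li lj) eqxx in lk.
have hbc : E (col k) b c.
  have [l hl] := ex _ _ bK cK' bc; suff <- : l = k by [].
  apply: third; rewrite eq_sym.
    by apply: (dis b a c) => //; edge.
  by apply: (dis c a b) => //; edge.
have hbd : E (col j) b d.
  have [l hl] := ex _ _ bK dK bd; suff <- : l = j by [].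
  apply: third'; rewrite eq_sym.
    by apply: (dis b a d) => //; edge.
  by apply: (dis d a b) => //; edge.
have hcd : E (col i) c d.
  have [l hl] := ex _ _ cK' dK cd; suff <- : l = i by [].
  apply: third''; rewrite eq_sym.
    by apply: (dis c a d) => //; edge.
  by apply: (dis d a c) => //; edge.
have hijk := col_edge ij ik jk.
exists (fun t : vec => match t with
  | (true, false, false) => col i | (false, true, false) => col j
  | (true, true, false) => col k | (false, false, true) => a
  | (true, false, true) => b | (false, true, true) => c | _ => d end).
  by case=> [[[] []] []] [[[] []] []] //= _ _ _; edge.
by case=> [[[] []] []] //= _; rewrite ?colW //; apply: sK.
Qed.

Lemma noK4_or_fano :
  noK4 E col (W :\ col o0 :\ col o1 :\ col o2) \/ fano_in W.
Proof.
set R := W :\ _ :\ _ :\ _.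
have [/existsP[K /and3P[sK cK K4']]|h] := boolP [exists K : {set V}, [&& K \subset R,
    cliqueb (fun u v => 0 < wt E col u v) K & 3 < #|K|]].
  right; apply: (@K4_fano K) => //.
  - apply: subset_trans sK _; do 2!apply: subset_trans (subsetDl _ _) _; exact: subsetDl.
  - by move=> c /(subsetP sK); apply: outR.
  - exact/cliqueP.
left=> K sK cK; rewrite leqNgt; apply: contra h => K4'; apply/existsP; exists K.
by rewrite sK K4' andbT; apply/cliqueP.
Qed.

End OneEdge.

Definition fcol x y z (i : 'I_3) := nth x [:: x; y; z] i.

Lemma fcol_edge x y z : E x y z -> forall i j k, i != j -> i != k -> j != k ->
  E (fcol x y z i) (fcol x y z j) (fcol x y z k).
Proof.
move=> h i j k; case: (ord3 i) (ord3 j) (ord3 k) => [] -> [] -> [] -> //= _ _ _;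
  rewrite /fcol /=; edge.
Qed.

Lemma fcolW x y z W : x \in W -> y \in W -> z \in W -> forall k, fcol x y z k \in W.
Proof. by move=> xW yW zW k; case: (ord3 k) => ->. Qed.

Lemma N3_gt0 W : 0 < N3 E W -> exists x y z, [/\ x \in W, y \in W, z \in W & E x y z].
Proof.
rewrite lt0n sum_nat_eq0 negb_forall => /existsP[x]; rewrite negb_imply => /andP[xW].
rewrite sum_nat_eq0 negb_forall => /existsP[y]; rewrite negb_imply => /andP[yW].
rewrite sum_nat_eq0 negb_forall => /existsP[z]; rewrite negb_imply => /andP[zW].
by rewrite eqb0 negbK => h; exists x, y, z.
Qed.

Lemma fano_bound W : fano_in W ->
  {in W, forall v, N3 E (W :\ v) <= 6 * (s3 #|W|.-1 + (#|W|.-1 == 5))} ->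
  N3 E W < 6 * s3 #|W|.
Proof.
case=> pt line ptW IH; apply: (fano_lt symE K4 F6 line ptW) => v vW.
have W7 : 7 <= #|W|.
  rewrite -card_vec -(card_in_imset (f := pt)) => [|i j]; last first.
    by rewrite !inE; apply: (pt_inj symE line).
  by apply/subset_leq_card/subsetP=> w /imsetP[i i0 ->]; rewrite inE in i0; apply: ptW.
by have := IH v vW; case: eqP => // e; move: W7 e; clear; lia.
Qed.

Lemma fano_strict W : fano_in W -> (forall W', W' \proper W -> N3 E W' <= 6 * s3 #|W'|) ->
  N3 E W < 6 * s3 #|W|.
Proof.
move=> fano IH; apply: (fano_bound fano) => v vW.
have := IH _ (properD1 vW); have := cardsD1 v W; rewrite vW add1n => -> /=.
by rewrite mulnDr => h; apply: leq_trans h (leq_addr _ _).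
Qed.

(** The cyclic order of this copy of C5 is b, a, x, z, y. *)
Definition noC5 := forall a b x y z,
  E a b x -> E a b y -> E x y z -> E a z x -> E b z y -> False.

Lemma noC5_zeta x y z : noC5 -> E x y z ->
  forall a b i j k, i != j -> i != k -> j != k ->
    out (fcol x y z) a -> out (fcol x y z) b ->
    E (fcol x y z i) a b -> E (fcol x y z j) a b ->
    E a (fcol x y z k) (fcol x y z i) -> E b (fcol x y z k) (fcol x y z j) -> false.
Proof.
move=> nC h a b i j k ij ik jk _ _ h1 h2 h3 h4.
have h5 := fcol_edge h ij ik jk.
by case: (nC a b (fcol x y z i) (fcol x y z j) (fcol x y z k)); edge.
Qed.

Lemma noC5_bound W : noC5 -> N3 E W <= 6 * s3 #|W|.
Proof.
move=> nC; have [n] := ubnP #|W|; elim: n W => // n IHn W ltW.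
have IH W' : W' \proper W -> N3 E W' <= 6 * s3 #|W'|.
  by move=> /proper_card lt; apply: IHn; apply: leq_trans lt _.
have [->//|/N3_gt0[x [y [z [xW yW zW h]]]]] := posnP (N3 E W).
have cW := fcolW xW yW zW; have cE := fcol_edge h.
case: (noK4_or_fano cE cW) => [nk|fano].
  by have [] := step_noC5 symE K4 F6 cE cW (noC5_zeta nC h) nk IH.
exact/ltnW/fano_strict.
Qed.

(** The edge xyz and a pair ab with two of the colours given by it. *)
Definition F5_in W := exists a b x y z,
  [/\ [/\ a \in W, b \in W, x \in W, y \in W & z \in W], E a b x, E a b y & E x y z].

Lemma F5_neq a b x y z : E a b x -> E a b y -> E x y z ->
  [/\ a != x, a != y, a != z & [/\ b != x, b != y & b != z]].
Proof.
move=> h1 h2 h3; have [_ -> ->] := tri_neq symE h1; have [_ -> ->] := tri_neq symE h2.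
split=> //; [|split=> //]; apply/eqP => e; subst z.
- by k4 a b x y.
- by k4 b a x y.
Qed.

Lemma noC5_strict W : noC5 -> 5 < #|W| -> F5_in W -> N3 E W < 6 * s3 #|W|.
Proof.
move=> nC W5 [a [b [x [y [z [[aW bW xW yW zW] h1 h2 h3]]]]]].
have IH W' : W' \proper W -> N3 E W' <= 6 * s3 #|W'| by move=> _; apply: noC5_bound.
have cW := fcolW xW yW zW; have cE := fcol_edge h3.
case: (noK4_or_fano cE cW) => [nk|fano]; last exact: fano_strict.
have [_ strict _] := step_noC5 symE K4 F6 cE cW (noC5_zeta nC h3) nk IH.
apply: strict => //; exists a, b.
have [ax ay az [bx by_ bz]] := F5_neq h1 h2 h3.
split.
- by rewrite !inE /fcol /= ax ay az.
- by rewrite !inE /fcol /= bx by_ bz.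
- rewrite /wt !big_ord_recl big_ord0 /fcol /=.
  have -> : E x a b by edge.
  by have -> : E y a b by edge.
Qed.

(** The three pairs of the edge that c may complete are its joins; for c on the edge itself the
    sum is one by irreflexivity. *)
Lemma noC5_equality W x y z : noC5 -> x \in W -> y \in W -> z \in W -> E x y z ->
  ~ F5_in W -> N3 E W = 6 * s3 #|W| ->
  {in W, forall c, E c x y + E c x z + E c y z = 1}.
Proof.
move=> nC xW yW zW h nF eN c cWin.
have IH W' : W' \proper W -> N3 E W' <= 6 * s3 #|W'| by move=> _; apply: noC5_bound.
have cW := fcolW xW yW zW; have cE := fcol_edge h.
have irr u v : E u u v = false by rewrite (triirr symE).
have irr' u v : E u v u = false by rewrite (tri132 symE) irr.
have [ex|cx] := eqVneq c x; first by subst c; rewrite !irr h.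
have [ey|cy] := eqVneq c y.
  by subst c; rewrite irr irr'; have -> : E y x z by edge.
have [ez|cz] := eqVneq c z.
  by subst c; rewrite !irr'; have -> : E z x y by edge.
case: (noK4_or_fano cE cW) => [nk|fano]; last by have := fano_strict fano IH; rewrite eN ltnn.
have [_ _ /(_ eN) equal] := step_noC5 symE K4 F6 cE cW (noC5_zeta nC h) nk IH.
apply: equal; last by rewrite !inE /fcol /= cx cy cz.
move=> u v uR vR; rewrite leqNgt; apply/negP => /wt2[i [j [ij h1 h2]]].
have [k ki [kj _]] := third ij.
have ik : i != k by rewrite eq_sym.
have jk : j != k by rewrite eq_sym.
have h3 := cE _ _ _ ij ik jk.
apply: nF; exists u, v, (fcol x y z i), (fcol x y z j), (fcol x y z k).
move: uR vR; rewrite !inE => /and4P[_ _ _ uW] /and4P[_ _ _ vW].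
by split; [split|edge|edge|].
Qed.

Definition C5_in W a b x y z :=
  [/\ [/\ a \in W, b \in W, x \in W, y \in W & z \in W],
    E a b x, E a b y, E x y z & E a z x /\ E b z y].

Lemma C5_bound W a b x y z : C5_in W a b x y z ->
  (forall W', W' \proper W -> N3 E W' <= 6 * (s3 #|W'| + (#|W'| == 5))) ->
  if #|W| == 5 then N3 E W <= 30 else N3 E W < 6 * s3 #|W|.
Proof.
move=> [[aW bW xW yW zW] h1 h2 h3 [h4 h5]] IH.
have cW := fcolW xW yW zW; have cE := fcol_edge h3.
have [ax ay az [bx by_ bz]] := F5_neq h1 h2 h3.
case: (noK4_or_fano cE cW) => [nk|fano]; last first.
  have : N3 E W < 6 * s3 #|W|.
    apply: (fano_bound fano) => v vW.
    have e := cardsD1 v W; rewrite vW add1n in e.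
    by rewrite e /=; apply: IH; apply: properD1.
  by case: eqP => // -> lt; rewrite (leq_trans (ltnW lt)).
by apply: (step_C5 symE K4 F6 cE cW (i := o0) (j := o1) (k := o2) _ _ _ (a := a) (b := b) _ _
  _ _ _ _ nk IH) => //; rewrite ?inE /fcol /= ?ax ?ay ?az ?bx ?by_ ?bz //; edge.
Qed.

End Assembly.

(** * The bound and the case of equality *)
Section Bound.
Variables (V : finType) (E : V -> V -> V -> bool).
Hypotheses (symE : trisym E) (K4 : K4m_free E) (F6 : F6_free E).
Implicit Types W : {set V}.

(** The restriction of the 3-graph to W, in which the absence of C5 is a global property. *)
Definition within (W : {set V}) x y z := [&& E x y z, x \in W, y \in W & z \in W].

Lemma within_sym W : trisym (within W).
Proof.
split=> [x y z|x y z|x z]; rewrite /within.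
- by rewrite (tri213 symE); case: (x \in W); case: (y \in W).
- by rewrite (tri132 symE); case: (y \in W); case: (z \in W).
- by rewrite (triirr symE).
Qed.

Lemma within_K4 W : K4m_free (within W).
Proof. by move=> a b c d /and4P[h1 _ _ _] /and4P[h2 _ _ _] /and4P[h3 _ _ _]; apply: K4 h1 h2 h3. Qed.

Lemma within_F6 W : F6_free (within W).
Proof.
move=> a b c d e f /and4P[h1 _ _ _] /and4P[h2 _ _ _] /and4P[h3 _ _ _] /and4P[h4 _ _ _].
exact: F6 h1 h2 h3 h4.
Qed.

Lemma within_N3 W : N3 (within W) W = N3 E W.
Proof.
apply: eq_bigr => x xW; apply: eq_bigr => y yW; apply: eq_bigr => z zW.
by rewrite /within xW yW zW !andbT.
Qed.

Lemma C5_dec W : (exists a b x y z, C5_in E W a b x y z) \/ noC5 (within W).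
Proof.
have [|h] := boolP [exists a, exists b, exists x, exists y, exists z,
  [&& within W a b x, within W a b y, within W x y z, within W a z x & within W b z y]].
  case/existsP=> a /existsP[b /existsP[x /existsP[y /existsP[z]]]].
  case/and5P => /and4P[h1 aW bW xW] /and4P[h2 _ _ yW] /and4P[h3 _ _ zW] /and4P[h4 _ _ _] /and4P[h5 _ _ _].
  by left; exists a, b, x, y, z.
right=> a b x y z h1 h2 h3 h4 h5; case/existsP: h; exists a; apply/existsP; exists b.
by apply/existsP; exists x; apply/existsP; exists y; apply/existsP; exists z; apply/and5P.
Qed.

Lemma N3_bound W : N3 E W <= 6 * (s3 #|W| + (#|W| == 5)).
Proof.
have [n] := ubnP #|W|; elim: n W => // n IHn W ltW.
have IH (W' : {set V}) : W' \proper W -> N3 E W' <= 6 * (s3 #|W'| + (#|W'| == 5)).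
  by move=> /proper_card lt; apply: IHn; apply: leq_trans lt _.
case: (C5_dec W) => [[a [b [x [y [z c5]]]]]|nC]; last first.
  have := noC5_bound (within_sym W) (@within_K4 W) (@within_F6 W) W nC.
  by rewrite within_N3 mulnDr => h; apply: leq_trans h (leq_addr _ _).
have := C5_bound symE K4 F6 c5 IH; case: eqP => [-> //|_ lt].
by rewrite addn0 ltnW.
Qed.

Lemma N3_bound5 W : N3 E W = 30 -> #|W| = 5 -> exists a b x y z, C5_in E W a b x y z.
Proof.
move=> e n5; case: (C5_dec W) => // nC.
have := noC5_bound (within_sym W) (@within_K4 W) (@within_F6 W) W nC.
by rewrite within_N3 e n5.
Qed.

Lemma F5_in_strict W : 5 < #|W| -> F5_in E W -> N3 E W < 6 * s3 #|W|.
Proof.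
move=> W5 f5; case: (C5_dec W) => [[a [b [x [y [z c5]]]]]|nC].
  have := C5_bound symE K4 F6 c5 (fun W' _ => N3_bound W').
  by case: eqP => // e; rewrite e in W5.
have := noC5_strict (within_sym W) (@within_K4 W) (@within_F6 W) nC W5.
rewrite within_N3; apply; move: f5 => [a [b [x [y [z [[aW bW xW yW zW] h1 h2 h3]]]]]].
by exists a, b, x, y, z; rewrite /within aW bW xW yW zW h1 h2 h3.
Qed.

Lemma F5_in_card W : F5_in E W -> 4 < #|W|.
Proof.
move=> [a [b [x [y [z [[aW bW xW yW zW] h1 h2 h3]]]]]].
have [ax ay az [bx by_ bz]] := F5_neq symE K4 h1 h2 h3.
have [ab _ _] := tri_neq symE h1; have [xy xz yz] := tri_neq symE h3.
have u5 : uniq [:: a; b; x; y; z] by rewrite /= !inE !negb_or ab ax ay az bx by_ bz xy xz yz.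
have <- : #|[set:: [:: a; b; x; y; z]]| = 5 by rewrite cardsE (card_uniqP u5).
by apply/subset_leq_card/subsetP => v; rewrite !inE => /or4P[/eqP->|/eqP->|/eqP->|/orP[]/eqP->].
Qed.

Lemma C5_F5 W a b x y z : C5_in E W a b x y z -> F5_in E W.
Proof. by case=> h h1 h2 h3 _; exists a, b, x, y, z. Qed.

(** The class of a vertex is the vertex of a fixed edge opposite to the pair with which it forms
    an edge. Two vertices u, v of one class form edges with the same pair of the fixed edge, and
    together with an edge uvw these give the configuration of F5_in. *)
Lemma N3_equality W : 2 < #|W| -> #|W| != 5 -> N3 E W = 6 * s3 #|W| ->
  exists A B C : {set V}, [/\ {in W, forall v, (v \in A) + (v \in B) + (v \in C) = 1} &
    {in W & &, forall u v w, E u v w -> ~~ ((u \in A) && (v \in A)) /\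
       ~~ ((u \in B) && (v \in B)) /\ ~~ ((u \in C) && (v \in C))}].
Proof.
move=> W3 W5 eN.
have nF : ~ F5_in E W.
  move=> f5; have := F5_in_card f5; rewrite leq_eqVlt eq_sym (negbTE W5) /= => lt.
  by have := F5_in_strict lt f5; rewrite eN ltnn.
have nC : noC5 (within W).
  by case: (C5_dec W) => // -[a [b [x [y [z /C5_F5]]]]].
have spos : 0 < s3 #|W| by rewrite /s3 !muln_gt0; move: W3; clear; lia.
have [x [y [z [xW yW zW h]]]] : exists x y z, [/\ x \in W, y \in W, z \in W & E x y z].
  by apply: N3_gt0; rewrite eN; move: spos; clear; lia.
have hW : within W x y z by rewrite /within h xW yW zW.
have nF' : ~ F5_in (within W) W.
  move=> [a [b [p [q [r [mem /and4P[h1 _ _ _] /and4P[h2 _ _ _] /and4P[h3 _ _ _]]]]]]].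
  by apply: nF; exists a, b, p, q, r.
have := noC5_equality (within_sym W) (@within_K4 W) (@within_F6 W) nC xW yW zW hW nF'.
rewrite within_N3 => /(_ eN) cls.
exists [set v | E v y z], [set v | E v x z], [set v | E v x y]; split=> [v vW|u v w uW vW wW huvw].
  by rewrite !inE; have := cls v vW; rewrite /within vW xW yW zW !andbT; clear; lia.
have rot p q r : E p q r -> E q r p by rewrite (tri213 symE) (tri132 symE).
by do 2?[split]; rewrite !inE; apply/negP => /andP[h1 h2]; apply: nF;
  [exists y, z, u, v, w|exists x, z, u, v, w|exists x, y, u, v, w]; split=> //; apply: rot.
Qed.

End Bound.

(** * The ternary relation of a 3-graph *)
Definition adj (V : finType) (G : graph3 V) (x y z : V) := [set x; y; z] \in edges G.

Lemma card_edge (V : finType) (G : graph3 V) e : e \in edges G -> #|e| = 3.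
Proof. by move/(forall_inP (edgesP G))/eqP. Qed.

Lemma set3C12 (T : finType) (x y z : T) : [set x; y; z] = [set y; x; z].
Proof. by rewrite (setUC [set x]). Qed.

Lemma set3C23 (T : finType) (x y z : T) : [set x; y; z] = [set x; z; y].
Proof. by rewrite -!setUA (setUC [set y]). Qed.

Lemma adj_sym (V : finType) (G : graph3 V) : trisym (adj G).
Proof.
split=> [x y z|x y z|x z]; rewrite /adj.
- by rewrite set3C12.
- by rewrite set3C23.
- by apply/negP=> /card_edge; rewrite setUid cards2; case: (_ != _).
Qed.

Lemma cards3P (T : finType) (e : {set T}) : #|e| = 3 ->
  exists x y z, [/\ x != y, x != z, y != z & e = [set x; y; z]].
Proof.
move=> e3; have [x xe h] := @card_gt0P2 _ e 2 ltac:(by rewrite e3).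
have [y ye h'] := card_gt0P2 h; have [z ze _] := card_gt0P2 h'.
move: ye ze; rewrite !inE => /andP[yx ye] /and3P[zy zx ze].
exists x, y, z; split; rewrite 1?eq_sym //; apply/esym/eqP.
rewrite eqEcard !subUset !sub1set xe ye ze e3 setUC cardsU1 cards2 !inE negb_or.
by rewrite zx zy eq_sym yx.
Qed.

Lemma card_set3 (T : finType) (x y z : T) : x != y -> x != z -> y != z -> #|[set x; y; z]| = 3.
Proof.
by move=> xy xz yz; rewrite setUC cardsU1 cards2 !inE negb_or !(eq_sym z) xy xz yz.
Qed.

Lemma set3_neq (T : finType) (x y z : T) : #|[set x; y; z]| = 3 ->
  [/\ x != y, x != z & y != z].
Proof.
have le2 (u v : T) : #|[set u; u; v]| <= 2 by rewrite setUid cards2; case: (_ != _).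
move=> e3; split; apply/eqP=> e; subst; move: e3.
- by have := le2 y z => /[swap] ->.
- by rewrite set3C23; have := le2 z y => /[swap] ->.
- by rewrite set3C12 set3C23; have := le2 z x => /[swap] ->.
Qed.

Lemma N3_edges (V : finType) (G : graph3 V) : N3 (adj G) setT = 6 * #|edges G|.
Proof.
have ext (F : V -> nat) : \sum_(x in [set: V]) F x = \sum_x F x.
  by apply: eq_bigl => x; rewrite inE.
have -> : N3 (adj G) setT = \sum_x \sum_y \sum_z \sum_(e in edges G) ([set x; y; z] == e).
  rewrite /N3 ext; apply: eq_bigr => x _; rewrite /psum ext; apply: eq_bigr => y _.
  rewrite ext; apply: eq_bigr => z _; rewrite /adj.
  have [h|h] := boolP (_ \in _).
    by rewrite (bigD1 _ h) eqxx big1 // => e /andP[_]; rewrite eq_sym => /negbTE->.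
  by rewrite big1 // => e he; case: eqP => // e'; rewrite e' he in h.
under eq_bigr do under eq_bigr do rewrite exchange_big.
under eq_bigr do rewrite exchange_big.
rewrite exchange_big mulnC -sum_nat_const; apply: eq_bigr => e /card_edge e3 /=.
have cnt x y z : ([set x; y; z] == e) = [&& x \in e, y \in e :\ x & z \in e :\ x :\ y].
  apply/eqP/and3P => [h|].
    have [xy xz yz] : [/\ x != y, x != z & y != z] by apply: set3_neq; rewrite h.
    by rewrite -h !inE !eqxx !orbT !(eq_sym y) !(eq_sym z) xy xz yz.
  rewrite !inE => -[xe /andP[yx ye] /and3P[zy zx ze]]; apply/eqP.
  rewrite eqEcard !subUset !sub1set xe ye ze e3 card_set3 //; by rewrite eq_sym.
have cnt3 (F : V -> bool) (A : {set V}) : F =1 (fun z => z \in A) -> \sum_z F z = #|A|.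
  by move=> h; rewrite -sum1_card [RHS]big_mkcond; apply: eq_bigr => z _; rewrite h.
transitivity (\sum_(x in e) \sum_(y in e :\ x) #|e :\ x :\ y|).
  rewrite [RHS]big_mkcond; apply: eq_bigr => x _; case: (boolP (x \in e)) => xe; last first.
    by rewrite big1 // => y _; rewrite big1 // => z _; rewrite cnt (negbTE xe).
  rewrite [RHS]big_mkcond; apply: eq_bigr => y _; case: (boolP (y \in e :\ x)) => ye; last first.
    by rewrite big1 // => z _; rewrite cnt (negbTE ye) andbF.
  by apply: cnt3 => z; rewrite cnt xe ye.
rewrite (eq_bigr (fun=> 2)) => [|x xe]; first by rewrite sum_nat_const e3.
have c2 : #|e :\ x| = 2 by have := cardsD1 x e; rewrite xe e3 => -[].
rewrite (eq_bigr (fun=> 1)) => [|y ye]; first by rewrite sum_nat_const c2.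
by have := cardsD1 y (e :\ x); rewrite ye c2 => -[].
Qed.

(** * Copies of the forbidden 3-graphs *)

Lemma imset_triple (V : finType) n (f : 'I_n -> V) p q r
    (hp : p < n) (hq : q < n) (hr : r < n) :
  f @: triple n p.+1 q.+1 r.+1 = [set f (Ordinal hp); f (Ordinal hq); f (Ordinal hr)].
Proof.
have -> : triple n p.+1 q.+1 r.+1 = [set Ordinal hp; Ordinal hq; Ordinal hr].
  by apply/setP => i; rewrite !inE !eqSS -!val_eqE /= orbA.
by rewrite !imsetU !imset_set1.
Qed.

Lemma nth_ffun_inj (V : finType) (s : seq V) n v0 : uniq s -> size s = n ->
  injectiveb [ffun i : 'I_n => nth v0 s i].
Proof.
move=> us sn; apply/injectiveP => i j; rewrite !ffunE => /eqP.
by rewrite nth_uniq ?sn // => /eqP/val_inj.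
Qed.

Lemma free_K4m (V : finType) (G : graph3 V) : ~~ contains G K4m -> K4m_free (adj G).
Proof.
move=> nc a b c d h1 h2 h3; case/existsP: nc.
have symG := adj_sym G.
have [ab ac bc] := tri_neq symG h1; have [_ ad bd] := tri_neq symG h2.
have [_ _ cd] := tri_neq symG h3.
have us : uniq [:: a; b; c; d] by rewrite /= !inE !negb_or ab ac ad bc bd cd.
exists [ffun i : 'I_4 => nth a [:: a; b; c; d] i]; rewrite nth_ffun_inj //=.
by apply/forall_inP => e; rewrite !inE -orbA => /or3P[]/eqP->; rewrite imset_triple !ffunE.
Qed.

Lemma free_F6 (V : finType) (G : graph3 V) : K4m_free (adj G) -> ~~ contains G F6 ->
  F6_free (adj G).
Proof.
move=> K4 nc a b c d e f h1 h2 h3 h4.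
have [fb|fb] := eqVneq f b; first by constructor 1.
have [fc|fc] := eqVneq f c; first by constructor 2.
have [fd|fd] := eqVneq f d; first by constructor 3.
exfalso; case/existsP: nc; have symG := adj_sym G.
have [ab ac bc] := tri_neq symG h1; have [_ ad bd] := tri_neq symG h2.
have [cd ce de] := tri_neq symG h3; have [ae af ef] := tri_neq symG h4.
have [_ _ _ [_ _ be]] := F5_neq symG K4 h1 h2 h3.
have us : uniq [:: a; b; c; d; e; f].
  by rewrite /= !inE !negb_or ab ac ad ae af bc bd be (eq_sym b f) fb
    cd ce (eq_sym c f) fc de (eq_sym d f) fd ef.
exists [ffun i : 'I_6 => nth a [:: a; b; c; d; e; f] i]; rewrite nth_ffun_inj //=.
by apply/forall_inP => t; rewrite !inE -!orbA => /or4P[]/eqP->; rewrite imset_triple !ffunE.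
Qed.

Lemma freeP (V : finType) (G : graph3 V) : free K4m_F6 G ->
  [/\ trisym (adj G), K4m_free (adj G) & F6_free (adj G)].
Proof.
case/and3P => /free_K4m h4 h6 _; split=> //; first exact: adj_sym.
exact: free_F6.
Qed.

(** * Extremal 3-graphs and isomorphisms *)

Lemma isomorphic_sym (V W : finType) (G : graph3 V) (H : graph3 W) :
  isomorphic G H -> isomorphic H G.
Proof.
case=> f [g fK gK] fE; exists g; first by exists f.
by move=> e; rewrite fE -imset_comp (eq_imset _ gK) imset_id.
Qed.

(** The injective image of the edges of G has the size of the edges of H, so one inclusion is
    enough. *)
Lemma isomorphic_sub (V W : finType) (G : graph3 V) (H : graph3 W) (f : V -> W) :
  bijective f -> #|edges G| = #|edges H| ->
  (forall e, e \in edges G -> f @: e \in edges H) -> isomorphic G H.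
Proof.
move=> bf cE fE; exists f => // e; have injf := bij_inj bf.
have -> : edges H = (fun e' : {set V} => f @: e') @: edges G.
  apply/esym/eqP; rewrite eqEcard card_imset; last exact: imset_inj.
  by rewrite cE leqnn andbT; apply/subsetP=> _ /imsetP[e' he' ->]; apply: fE.
by rewrite mem_imset //; apply: imset_inj.
Qed.

Lemma N3_le (V : finType) (G : graph3 V) : free K4m_F6 G ->
  #|edges G| <= s3 #|V| + (#|V| == 5).
Proof.
case/freeP => symG K4 F6; have := N3_bound symG K4 F6 [set: V].
by rewrite N3_edges cardsT leq_mul2l.
Qed.

Lemma exnE n (H : graph3 'I_n) : free K4m_F6 H -> #|edges H| = s3 n + (n == 5) ->
  exn n K4m_F6 = s3 n + (n == 5).
Proof.
move=> fH cH; apply/eqP; rewrite eqn_leq; apply/andP; split.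
  by apply/bigmax_leqP => G /N3_le; rewrite card_ord.
by rewrite -cH; apply: (leq_bigmax_cond (F := fun G : graph3 'I_n => #|edges G|)).
Qed.

(** * Transversals of a partition into three classes *)

Section Transversals.
Variables (V : finType) (A B C : {set V}).
Hypothesis ABC : forall v, (v \in A) + (v \in B) + (v \in C) = 1.

Definition transversals : {set {set V}} :=
  [set e | [&& #|e :&: A| == 1, #|e :&: B| == 1 & #|e :&: C| == 1]].

Let notin v : [/\ v \in A -> (v \in B = false) * (v \in C = false),
  v \in B -> (v \in A = false) * (v \in C = false) &
  v \in C -> (v \in A = false) * (v \in B = false)].
Proof. by split; move: (ABC v); do 3!case: (_ \in _). Qed.

Lemma set3I a b c : a \in A -> b \in B -> c \in C ->
  [/\ [set a; b; c] :&: A = [set a], [set a; b; c] :&: B = [set b] &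
      [set a; b; c] :&: C = [set c]].
Proof.
move=> aA bB cC; have [/(_ aA) a' _ _] := notin a; have [_ /(_ bB) b' _] := notin b.
have [_ _ /(_ cC) c'] := notin c.
split; apply/setP => v; rewrite !inE.
- by have [->|_] := eqVneq v a; rewrite ?aA //; have [->|_] := eqVneq v b;
    rewrite ?b' //; have [->|//] := eqVneq v c; rewrite c'.
- by have [->|_] := eqVneq v b; rewrite ?bB ?orbT //; have [->|_] := eqVneq v a;
    rewrite ?a' //; have [->|//] := eqVneq v c; rewrite c'.
- by have [->|_] := eqVneq v c; rewrite ?cC ?orbT //; have [->|_] := eqVneq v a;
    rewrite ?a' //; have [->|//] := eqVneq v b; rewrite b'.
Qed.

Lemma transversalsP e :
  reflect (exists a b c, [/\ a \in A, b \in B, c \in C & e = [set a; b; c]])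
    (e \in transversals).
Proof.
rewrite inE; apply: (iffP and3P) => [[/cards1P[a ea] /cards1P[b eb] /cards1P[c ec]]|].
  have [[ae aA] [be bB] [ce cC]] : [/\ a \in e /\ a \in A, b \in e /\ b \in B & c \in e /\ c \in C].
    by split; apply/andP; rewrite -in_setI (ea, eb, ec) set11.
  exists a, b, c; split=> //; apply/setP => v; rewrite !inE.
  have := ABC v; move/setP/(_ v): ea; move/setP/(_ v): eb; move/setP/(_ v): ec.
  rewrite !inE => <- <- <-.
  by case: (v \in e) => //=; do 3!case: (_ \in _).
by move=> [a [b [c [aA bB cC ->]]]]; have [-> -> ->] := set3I aA bB cC; rewrite !cards1.
Qed.

Lemma card_transversals : #|transversals| = #|A| * #|B| * #|C|.
Proof.
rewrite -!cardsX; set X := setX (setX A B) C.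
have <- : (fun p => [set p.1.1; p.1.2; p.2]) @: X = transversals.
  apply/setP => e; apply/imsetP/transversalsP => [[[[a b] c]]|[a [b [c [aA bB cC ->]]]]].
    by rewrite !inE /= => /andP[/andP[aA bB] cC] ->; exists a, b, c.
  by exists (a, b, c); rewrite // !inE aA bB cC.
apply: card_in_imset => -[[a b] c] [[a' b'] c']; rewrite !inE /= => /andP[/andP[aA bB] cC].
move=> /andP[/andP[aA' bB'] cC'] eq3; have [ea eb ec] := set3I aA bB cC.
have [] := set3I aA' bB' cC'; rewrite -eq3 ea eb ec.
by move=> /set1_inj -> /set1_inj -> /set1_inj ->.
Qed.

End Transversals.

(** * The two extremal 3-graphs *)

Lemma ord3P (P : 'I_3 -> Prop) : P ord0 -> P (inord 1) -> P (inord 2) -> forall c, P c.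
Proof.
move=> h0 h1 h2 [[|[|[|//]]] c3].
- by have -> : Ordinal c3 = ord0 by apply: val_inj.
- by have -> : Ordinal c3 = inord 1 by apply: val_inj; rewrite /= inordK.
- by have -> : Ordinal c3 = inord 2 by apply: val_inj; rewrite /= inordK.
Qed.

Lemma S3_edgesE n : edges (S3 n) =
  transversals (S3_class n ord0) (S3_class n (inord 1)) (S3_class n (inord 2)).
Proof.
apply/setP => e; rewrite !inE; apply/forallP/and3P => [h|[h0 h1 h2]]; first by split; apply: h.
exact: ord3P.
Qed.

Lemma S3_partition n (v : 'I_n) : (v \in S3_class n ord0) + (v \in S3_class n (inord 1)) +
  (v \in S3_class n (inord 2)) = 1.
Proof. by rewrite !inE !inordK //=; lia. Qed.

Lemma card_S3 n : #|edges (S3 n)| = s3 n.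
Proof.
rewrite S3_edgesE card_transversals; last exact: S3_partition.
rewrite !card_S3_class !inordK //= subn0 addnK -addnBA // /s3.
by rewrite mulnC (mulnC ((n + 2) %/ 3)) mulnA.
Qed.

Lemma S3_residues n (x y z : 'I_n) : [set x; y; z] \in edges (S3 n) ->
  [/\ x %% 3 <> y %% 3, x %% 3 <> z %% 3 & y %% 3 <> z %% 3].
Proof.
move=> h; have [xy xz yz] := set3_neq (card_edge h); move: h; rewrite inE => /forallP h.
have key u v w : [set u; v; w] = [set x; y; z] -> u != v -> u %% 3 <> v %% 3.
  move=> e uv uv3; have /eqP := h (Ordinal (ltn_pmod u (isT : 0 < 3))); rewrite -e => h1.
  have : [set u; v] \subset [set u; v; w] :&: S3_class n (Ordinal (ltn_pmod u (isT : 0 < 3))).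
    by apply/subsetP => t; rewrite !inE /= => /orP[]/eqP->; rewrite eqxx ?orbT ?uv3 /=.
  by move/subset_leq_card; rewrite h1 cards2 uv.
split; first exact: (key x y z).
- by apply: (key x z y) => //; rewrite set3C23.
- by apply: (key y z x) => //; rewrite set3C23 set3C12.
Qed.

(** Both forbidden 3-graphs have edges abc and abd and a third edge on c and d. In S_3(n) the
    first two put c and d into the same class. *)
Lemma S3_free n : free K4m_F6 (S3 n).
Proof.
have clash (a b c d e : 'I_n) : [set a; b; c] \in edges (S3 n) ->
    [set a; b; d] \in edges (S3 n) -> [set c; d; e] \in edges (S3 n) -> False.
  move=> /S3_residues[h1 h2 h3] /S3_residues[_ h4 h5] /S3_residues[h6 _ _].
  by move: h1 h2 h3 h4 h5 h6; clear; lia.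
rewrite /free /= andbT; apply/andP; split; apply/existsP => -[f /andP[_ /forall_inP h]].
  have h1 := h (triple 4 1 2 3); have h2 := h (triple 4 1 2 4); have h3 := h (triple 4 1 3 4).
  rewrite !imset_triple in h1 h2 h3; rewrite set3C12 set3C23 in h3.
  by apply: clash (h1 _) (h2 _) (h3 _); rewrite !inE eqxx ?orbT.
have h1 := h (triple 6 1 2 3); have h2 := h (triple 6 1 2 4); have h3 := h (triple 6 3 4 5).
rewrite !imset_triple in h1 h2 h3.
by apply: clash (h1 _) (h2 _) (h3 _); rewrite !inE eqxx ?orbT.
Qed.

(** The lists of elements decide by computation whether explicit triples are distinct. *)
Lemma val_enum_triple n a b c :
  map val (enum (triple n a b c)) = [seq i <- iota 0 n | i.+1 \in [:: a; b; c]].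
Proof.
rewrite -val_enum_ord filter_map; congr (map _ _).
by rewrite {1}/enum_mem -enumT; apply: eq_filter => i; rewrite /= !inE.
Qed.

Lemma card_set_code n (s : seq {set 'I_n}) :
  uniq [seq map val (enum e) | e : {set 'I_n} <- s] -> #|[set e in s]| = size s.
Proof. by move/map_uniq => us; rewrite cardsE; apply/card_uniqP. Qed.

Lemma card_K4m : #|edges K4m| = 3.
Proof.
have -> : edges K4m = [set e in [:: triple 4 1 2 3; triple 4 1 2 4; triple 4 1 3 4]].
  by apply/setP => e; rewrite !inE -!orbA.
by rewrite card_set_code //= !val_enum_triple.
Qed.

Lemma card_C5 : #|edges C5| = 5.
Proof.
have -> : edges C5 = [set e in [:: triple 5 1 2 3; triple 5 2 3 4; triple 5 3 4 5;
    triple 5 1 4 5; triple 5 1 2 5]] by apply/setP => e; rewrite !inE -!orbA.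
by rewrite card_set_code //= !val_enum_triple.
Qed.

Lemma C5_avoid (v : 'I_5) : exists s t, forall e, e \in edges C5 -> v \notin e -> e \in [set s; t].
Proof.
have key s t : (forall e, e \in edges C5 -> v \notin e -> (e == s) || (e == t)) ->
  exists s t, forall e, e \in edges C5 -> v \notin e -> e \in [set s; t].
  by move=> h; exists s, t => e he ve; rewrite !inE h.
case: v key => -[|[|[|[|[|//]]]]] v5 key;
 [apply: (key (triple 5 2 3 4) (triple 5 3 4 5))
 |apply: (key (triple 5 3 4 5) (triple 5 1 4 5))
 |apply: (key (triple 5 1 4 5) (triple 5 1 2 5))
 |apply: (key (triple 5 1 2 3) (triple 5 1 2 5))
 |apply: (key (triple 5 1 2 3) (triple 5 2 3 4))];
 by move=> e; rewrite !inE -!orbA => /or4P[|||/orP[]] /eqP->; rewrite ?inE //= ?eqxx ?orbT.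
Qed.

(** F6 has too many vertices. A copy of K_4^- misses a vertex of C5, but only two edges of C5
    avoid a given vertex. *)
Lemma C5_free : free K4m_F6 C5.
Proof.
rewrite /free /= andbT; apply/andP; split;
  apply/existsP => -[f /andP[/injectiveP fI /forall_inP h]]; last first.
  by have := leq_card f fI; rewrite !card_ord.
have [v nv] : exists v, v \notin codom f.
  apply/existsP; rewrite -negb_forall; apply/negP => /forallP all_f.
  by have := card_codom fI; rewrite (eq_card (B := 'I_5)) ?card_ord //.
have [s [t st]] := C5_avoid v.
have : [set f @: (e : {set 'I_4}) | e in edges K4m] \subset [set s; t].
  apply/subsetP => _ /imsetP[e eK ->]; apply: st; first exact: h.
  by apply: contra nv => /imsetP[i _ ->]; apply: codom_f.
move/subset_leq_card; rewrite card_imset; last exact: imset_inj.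
by rewrite card_K4m cards2; case: (_ != _).
Qed.

(** * Uniqueness *)

(** Adding one vertex to each of three classes adds one edge, a + b + c edges and
    a b + b c + c a edges; the last number is at most (a + b + c)^2 / 3, as in s3_add3. *)
Lemma prod_s3_le a b c : a * b * c <= s3 (a + b + c).
Proof.
elim: c a b => [|c IHc] [|a] [|b]; rewrite ?muln0 ?mul0n //.
have -> : a.+1 + b.+1 + c.+1 = a + b + c + 3 by lia.
have : a * b + b * c + c * a <= (a + b + c) * (a + b + c) %/ 3.
  have := (nat_Cauchy a b).1; have := (nat_Cauchy b c).1; have := (nat_Cauchy c a).1.
  by rewrite leq_divRL // -!mulnn; clear; lia.
by rewrite s3_add3; move: (IHc a b); clear; lia.
Qed.

(** For classes with a difference of two or more, (a + b + c)^2 - 3 (a b + b c + c a) is at least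
    3, and one unit is lost even after rounding. *)
Lemma prod_s3_balanced a b c : 0 < c -> c <= b -> b <= a ->
  s3 (a + b + c) <= a * b * c -> a <= c.+1.
Proof.
case: c => // c _; case: b => // b; case: a => // a cb ba.
have -> : a.+1 + b.+1 + c.+1 = a + b + c + 3 by lia.
rewrite s3_add3 leqNgt => h; apply: contraNT h; rewrite -ltnNge => ca.
have : (a * b + b * c + c * a).+1 <= (a + b + c) * (a + b + c) %/ 3.
  have [d ed] : exists d, b = c + d by exists (b - c); lia.
  have [d' ed'] : exists d', a = c + d + d' by exists (a - b); lia.
  by rewrite leq_divRL //; subst; nia.
by have := prod_s3_le a b c; clear; lia.
Qed.

Lemma transversalsC12 (V : finType) (A B C : {set V}) : transversals A B C = transversals B A C.
Proof. by apply/setP => e; rewrite !inE andbCA. Qed.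

Lemma transversalsC23 (V : finType) (A B C : {set V}) : transversals A B C = transversals A C B.
Proof. by apply/setP => e; rewrite !inE; congr (_ && _); rewrite andbC. Qed.

Lemma card_partition3 (V : finType) (A B C : {set V}) :
  (forall v, (v \in A) + (v \in B) + (v \in C) = 1) -> #|A| + #|B| + #|C| = #|V|.
Proof.
move=> ABC; rewrite -!sum1_card ![\sum_(_ in pred_of_set _) _]big_mkcond -!big_split /=.
by apply: eq_bigr => v _; have := ABC v; do 3!case: (_ \in _).
Qed.

(** The vertices of the three classes are numbered by 0, 3, 6, ..., by 1, 4, 7, ... and by
    2, 5, 8, ... in this order; balance keeps the numbers below n. *)
Lemma balanced_S3 (V : finType) (G : graph3 V) n (A B C : {set V}) :
  (forall v, (v \in A) + (v \in B) + (v \in C) = 1) -> #|V| = n ->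
  edges G \subset transversals A B C -> #|edges G| = s3 n ->
  #|C| <= #|B| -> #|B| <= #|A| -> #|A| <= #|C|.+1 -> isomorphic G (S3 n).
Proof.
move=> ABC Vn GT cG CB BA AC; have abc := card_partition3 ABC; rewrite Vn in abc.
pose code v := if v \in A then 3 * index v (enum A) else
  if v \in B then 3 * index v (enum B) + 1 else 3 * index v (enum C) + 2.
have idx v (D : {set V}) : v \in D -> index v (enum D) < #|D|.
  by rewrite -mem_enum cardE index_mem.
have codeP v : [\/ v \in A /\ code v = 3 * index v (enum A),
    v \in B /\ code v = 3 * index v (enum B) + 1 |
    v \in C /\ code v = 3 * index v (enum C) + 2].
  rewrite /code; have := ABC v; case: (v \in A) => [_|]; first by constructor 1.
  by case: (v \in B) => [_|]; [constructor 2|case: (v \in C) => //; constructor 3].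
have code_lt v : code v < n.
  case: (codeP v) => -[/idx lt ->]; move: lt CB BA AC abc; clear; lia.
pose f v := Ordinal (code_lt v).
have f_inj : injective f.
  have idx_inj u v (D : {set V}) : u \in D -> v \in D ->
      index u (enum D) = index v (enum D) -> u = v.
    by rewrite -(mem_enum D u) -(mem_enum D v) => uD vD; exact: index_inj.
  move=> u v /(congr1 val) /=; move: (code u) (code v) (codeP u) (codeP v) => p q.
  by case=> -[uD ->] [] [vD ->] e; (try by exfalso; move: e; clear; lia);
    apply: idx_inj uD vD _; move: e; clear; lia.
apply: (@isomorphic_sub _ _ _ _ f).
- by apply: inj_card_bij f_inj _; rewrite card_ord Vn.
- by rewrite card_S3.
move=> e /(subsetP GT) /(transversalsP ABC) [a [b [c [aA bB cC ->]]]].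
rewrite S3_edgesE; apply/transversalsP; first exact: S3_partition.
exists (f a), (f b), (f c); rewrite !imsetU !imset_set1; split=> //; rewrite !inE ?inordK //=.
- by rewrite /code aA; apply/eqP; lia.
- have := ABC b; rewrite /code bB; case: (b \in A) => //= _; apply/eqP; lia.
- have := ABC c; rewrite /code cC; case: (c \in A) => //=; case: (c \in B) => //= _.
  by apply/eqP; lia.
Qed.

Lemma tripartite_S3 (V : finType) (G : graph3 V) n (A B C : {set V}) : 2 < n ->
  (forall v, (v \in A) + (v \in B) + (v \in C) = 1) -> #|V| = n ->
  edges G \subset transversals A B C -> #|edges G| = s3 n -> isomorphic G (S3 n).
Proof.
move=> n3 ABC Vn GT cG.
have sorted (A' B' C' : {set V}) : (forall v, (v \in A') + (v \in B') + (v \in C') = 1) ->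
    transversals A B C = transversals A' B' C' -> #|C'| <= #|B'| -> #|B'| <= #|A'| ->
    isomorphic G (S3 n).
  move=> ABC' eT CB BA; rewrite eT in GT; apply: (balanced_S3 ABC') => //.
  have h := subset_leq_card GT; rewrite cG (card_transversals ABC') in h.
  rewrite -Vn -(card_partition3 ABC') in h; apply: (prod_s3_balanced _ CB BA h).
  rewrite lt0n; apply: contraTneq n3 => C0; move: h; rewrite C0 muln0 addn0.
  rewrite -Vn -(card_partition3 ABC') C0 addn0 leqn0 /s3 !muln_eq0 -!orbA.
  by clear; lia.
have swap12 (A' B' C' : {set V}) : (forall v, (v \in A') + (v \in B') + (v \in C') = 1) ->
    forall v, (v \in B') + (v \in A') + (v \in C') = 1.
  by move=> h v; rewrite -(h v) (addnC (v \in B')).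
have swap23 (A' B' C' : {set V}) : (forall v, (v \in A') + (v \in B') + (v \in C') = 1) ->
    forall v, (v \in A') + (v \in C') + (v \in B') = 1.
  by move=> h v; rewrite -(h v) addnAC.
have ACB := swap23 _ _ _ ABC; have BAC := swap12 _ _ _ ABC.
have tACB := transversalsC23 A B C; have tBAC := transversalsC12 A B C.
have [AB|/ltnW BA] := leqP #|A| #|B|; have [BC|/ltnW CB] := leqP #|B| #|C|.
- apply: (sorted C B A) => //; first exact/swap12/swap23/swap12.
  by rewrite tBAC transversalsC23 transversalsC12.
- have [AC|/ltnW CA] := leqP #|A| #|C|; last exact: (sorted B A C).
  by apply: (sorted B C A) => //; [apply: swap23|rewrite tBAC transversalsC23].
- have [AC|/ltnW CA] := leqP #|A| #|C|; last exact: (sorted A C B).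
  by apply: (sorted C A B) => //; [apply: swap12|rewrite tACB transversalsC12].
- exact: (sorted A B C).
Qed.

Lemma S3_extremal n : 2 < n -> n <> 5 -> extremal n K4m_F6 (S3 n).
Proof.
move=> n3 /eqP/negbTE n5; split; [exact: card_ord|exact: S3_free|].
by rewrite (exnE (S3_free n)) n5 addn0 ?card_S3.
Qed.

Lemma C5_extremal : extremal 5 K4m_F6 C5.
Proof.
by split; [exact: card_ord|exact: C5_free|rewrite (exnE C5_free) card_C5].
Qed.

Lemma S3_unique n (V : finType) (G : graph3 V) : 2 < n -> n <> 5 ->
  extremal n K4m_F6 G -> isomorphic G (S3 n).
Proof.
move=> n3 n5 [Vn /freeP[symG K4 F6]]; have [_ _ <-] := S3_extremal n3 n5.
rewrite card_S3 => cG; have := @N3_equality _ _ symG K4 F6 setT.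
rewrite cardsT Vn N3_edges cG => /(_ n3) [|//|A [B [C [ABC ind]]]]; first exact/eqP.
have {}ABC v : (v \in A) + (v \in B) + (v \in C) = 1 by apply: ABC; rewrite inE.
apply: (tripartite_S3 n3 ABC Vn) cG; apply/subsetP => e eG; have e3 := card_edge eG.
have [x [y [z [xy xz yz ee]]]] := cards3P e3.
have le1 (D : {set V}) : (forall u v w, adj G u v w -> ~~ ((u \in D) && (v \in D))) ->
    #|e :&: D| <= 1.
  move=> hD; rewrite leqNgt; apply/negP => /card_gt1P[u [v [ ]]].
  rewrite !inE => /andP[ue uD] /andP[ve vD] uv.
  have [w we] : exists2 w, w \in e & e = [set u; v; w].
    have /card_gt0P[w] : 0 < #|e :\ u :\ v|.
      by have := cardsD1 u e; have := cardsD1 v (e :\ u); rewrite !inE ue ve eq_sym uv e3; clear; lia.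
    rewrite !inE => /and3P[wv wu we]; exists w => //; apply/esym/eqP.
    by rewrite eqEcard !subUset !sub1set ue ve we e3 card_set3 // eq_sym.
  by move=> eE; have := hD u v w; rewrite /adj -eE uD vD => /(_ eG).
have indT u v w : adj G u v w -> ~~ ((u \in A) && (v \in A)) /\
    ~~ ((u \in B) && (v \in B)) /\ ~~ ((u \in C) && (v \in C)).
  by apply: ind; rewrite inE.
have eA := le1 A (fun u v w h => (indT u v w h).1).
have eB := le1 B (fun u v w h => (indT u v w h).2.1).
have eC := le1 C (fun u v w h => (indT u v w h).2.2).
have : #|e :&: A| + #|e :&: B| + #|e :&: C| = 3.
  rewrite -e3 -!sum1_card ![\sum_(_ in pred_of_set _) _]big_mkcond -!big_split /=.
  apply: eq_bigr => v _; rewrite !inE; have := ABC v.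
  by case: (v \in e); do 3!case: (_ \in _).
by rewrite inE; move: eA eB eC; clear; lia.
Qed.

(** The bijection sends the labels 1, ..., 5 to the cyclic order of the copy of C5. *)
Lemma C5_unique (V : finType) (G : graph3 V) : extremal 5 K4m_F6 G -> isomorphic G C5.
Proof.
case=> Vn /freeP[symG K4 F6]; have [_ _ <-] := C5_extremal; rewrite card_C5 => cG.
have := @N3_bound5 _ _ symG K4 F6 setT; rewrite N3_edges cG cardsT => /(_ erefl Vn).
move=> [a [b [x [y [z [_ h1 h2 h3 [h4 h5]]]]]]].
have [ax ay az [bx by_ bz]] := F5_neq symG K4 h1 h2 h3.
have [ab _ _] := tri_neq symG h1; have [xy xz yz] := tri_neq symG h3.
have us : uniq [:: b; a; x; z; y].
  by rewrite /= !inE !negb_or (eq_sym b) (eq_sym z) ab ax ay az bx by_ bz xy xz yz.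
have /injectiveP f_inj := nth_ffun_inj a us (erefl 5).
apply: isomorphic_sym; apply: isomorphic_sub (inj_card_bij f_inj _) _ _.
- by rewrite card_ord Vn.
- by rewrite card_C5 cG.
move=> e; rewrite !inE -!orbA => /or4P[|||/orP[]] /eqP->; rewrite imset_triple !ffunE /=.
- by rewrite set3C12.
- by rewrite set3C23.
- by rewrite set3C23.
- exact: h5.
- by rewrite set3C12.
Qed.

Theorem theorem4 :
  (forall n : nat, 3 <= n -> n <> 5 -> unique_extremal n K4m_F6 (S3 n)) /\
  unique_extremal 5 K4m_F6 C5.
Proof.
split=> [n n3 n5|]; split=> [|V G].
- exact: S3_extremal.
- exact: S3_unique.
- exact: C5_extremal.
- exact: C5_unique.
Qed.
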